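(* Let $G=([n],E)$ be a connected simple graph with $n\ge 2$. If $G$ is chordal, then the spanning tree generating function $P_G$ is a homaloidal polynomial; equivalently, for every $k\in[n]$ the spanning tree concentration model $\mathcal{M}(G,k)$ has maximum likelihood degree one.
   Context: Attach to each edge $e\in E$ a variable $x_e$. The Laplacian $L(G)(\mathbf{x}_E)$ is the symmetric $n\times n$ matrix with off-diagonal entries $-x_{ij}$ if $ij\in E$ and $0$ if $i\neq j$, $ij\notin E$, and with diagonal entries $\sum_{j:\,ij\in E}x_{ij}$. For a vertex $k$, $L(G)_{\widehat k,\widehat k}$ is $L(G)$ with row and column $k$ deleted, and $\mathcal{M}(G,k)=\{L(G)_{\widehat k,\widehat k}(\mathbf{x}_E) : \mathbf{x}_E\in\mathbb{C}^{E}\}$. The spanning tree generating function is $P_G=\sum_{T}\prod_{e\in T}x_e$, summed over all spanning trees $T$ of $G$ (viewed as edge sets); by the matrix-tree theorem $P_G=\det L(G)_{\widehat k,\widehat k}$ for every $k$. $G$ is chordal if every cycle of $G$ with at least four vertices has a chord. A homogeneous polynomial $P\in\mathbb{C}[x_0,\dots,x_N]$ is homaloidal if the rational map $\mathbb{P}^N\dashrightarrow\mathbb{P}^N$, $t\mapsto\left(\frac{\partial P}{\partial x_0}(t):\cdots:\frac{\partial P}{\partial x_N}(t)\right)$, is birational. For a linear space $\mathcal{M}=\{K(\mathbf{x})=\sum_i x_iK_i\}$ of complex symmetric $m\times m$ matrices, with $K_i$ linearly independent, the maximum likelihood (ML) degree of $\mathcal{M}$ is the number of complex critical points $\mathbf{x}$,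 with $\det K(\mathbf{x})\neq 0$, of the log-likelihood function $\log\det K(\mathbf{x})-\operatorname{tr}(S K(\mathbf{x}))$, for generic complex symmetric $S$; that is, the number of solutions of $\partial_{x_i}\det K(\mathbf{x})/\det K(\mathbf{x})=\operatorname{tr}(SK_i)$ for all $i$. *)

(* Defs.v *)
From HB Require Import structures.
From mathcomp Require Export all_boot all_order all_algebra.
From mathcomp Require Export boolp classical_sets reals.
From mathcomp Require Export complex.
From mathcomp Require Export mpoly.

Set Implicit Arguments.
Unset Strict Implicit.
Unset Printing Implicit Defensive.

Import GRing.Theory.
Local Open Scope ring_scope.

Section Graphs.
Variables (n : nat) (g : rel 'I_n).

Definition connected_graph : Prop := forall i j, connect g i j.

(* A chord of the cycle c is an edge joining two vertices of c which are not
   consecutive along c. *)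
Definition has_chord (c : seq 'I_n) : Prop :=
  exists i j, [/\ i \in c, j \in c, g i j, j != next c i & i != next c j].

Definition chordal : Prop :=
  forall c : seq 'I_n, ucycle g c -> (4 <= size c)%N -> has_chord c.

(* For a symmetric g, [ucycle g [:: i; j]] holds on every edge, so genuine
   cycles are those with at least three vertices. *)
Definition acyclic : Prop :=
  forall c : seq 'I_n, ucycle g c -> (size c < 3)%N.

Definition edges : {set {set 'I_n}} :=
  [set A : {set 'I_n} | [exists i, exists j, g i j && (A == [set i; j])]].

End Graphs.

(* C^E is represented by 'rV_#|edges g|, and C[x_e : e in E] by
   {mpoly C[#|edges g|]}; the edge carrying the a-th variable is [enum_val a]. *)
Section SpanningTrees.
Variables (n : nat) (g : rel 'I_n).

Definition subgraph (T : {set 'I_#|edges g|}) : rel 'I_n :=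
  fun i j => (i != j) && [exists a in T, enum_val a == [set i; j]].

Definition spanning_tree (T : {set 'I_#|edges g|}) : Prop :=
  connected_graph (subgraph T) /\ acyclic (subgraph T).

Definition tree_poly (F : fieldType) : {mpoly F[#|edges g|]} :=
  \sum_(T : {set 'I_#|edges g|} | `[< spanning_tree T >]) \prod_(a in T) 'X_a.

Variables (F : fieldType) (x : 'rV[F]_#|edges g|).

(* x_ij, by convention 0 when ij is not an edge: the sum has at most one term *)
Definition edge_weight (i j : 'I_n) : F :=
  \sum_(a < #|edges g| | enum_val a == [set i; j]) x 0 a.

Definition laplacian : 'M[F]_n :=
  \matrix_(i, j) if i == j then \sum_(l | g i l) edge_weight i l
                 else - edge_weight i j.

Definition reduced_laplacian (k : 'I_n) : 'M[F]_n.-1 :=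
  row' k (col' k laplacian).

End SpanningTrees.

Definition tree_model (n : nat) (g : rel 'I_n) (F : fieldType) (k : 'I_n) :
    set 'M[F]_n.-1 :=
  [set A | exists x : 'rV[F]_#|edges g|, A = reduced_laplacian x k]%classic.
Arguments tree_model [n] g F k.

(* Rational maps P^(N-1) --> P^(N-1) are given by N-tuples of forms of the same
   degree, not all zero; two tuples give the same rational map iff they are
   proportional over the function field. *)
Section RationalMaps.
Variables (F : fieldType) (N : nat).
Implicit Types p q : N.-tuple {mpoly F[N]}.

Definition ratmap p : Prop :=
  (exists d : nat, forall i, tnth p i \is d.-homog) /\ (exists i, tnth p i != 0).

Definition ratmap_eq p q : Prop :=
  forall i j, tnth p i * tnth q j = tnth p j * tnth q i.

Definition ratmap_id : N.-tuple {mpoly F[N]} := [tuple 'X_i | i < N].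

(* the composite "q after p"; it is defined as a rational map exactly when the
   resulting tuple is not identically zero, i.e. satisfies [ratmap] *)
Definition ratmap_comp q p : N.-tuple {mpoly F[N]} :=
  [tuple (tnth q i) \mPo p | i < N].

Definition birational p : Prop :=
  ratmap p /\
  exists q, [/\ ratmap q,
                ratmap (ratmap_comp q p) /\ ratmap_eq (ratmap_comp q p) ratmap_id
              & ratmap (ratmap_comp p q) /\ ratmap_eq (ratmap_comp p q) ratmap_id].

Definition homaloidal (P : {mpoly F[N]}) : Prop :=
  (exists d : nat, P \is d.-homog) /\ birational [tuple P^`M(i) | i < N].

End RationalMaps.

Section MLDegree.
Variables (F : fieldType) (m : nat).
Implicit Types (M : set 'M[F]_m) (S : 'M[F]_m).

Definition symmetric_mx S : Prop := S^T = S.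

Section Parametrized.
Variables (N : nat) (K : N.-tuple 'M[F]_m).

Definition parametrizes M : Prop :=
  [/\ forall i, symmetric_mx (tnth K i),
      free K
    & M = [set A | exists x : 'rV[F]_N, A = \sum_i x 0 i *: tnth K i]%classic].

(* det K(x), as a polynomial in x *)
Definition det_poly : {mpoly F[N]} :=
  \det (\sum_i 'X_i *: map_mx (@mpolyC N F) (tnth K i)).

Definition critical_point S (x : 'rV[F]_N) : Prop :=
  det_poly.@[x 0] != 0 /\
  forall i, (det_poly^`M(i)).@[x 0] / det_poly.@[x 0] = \tr (S *m tnth K i).

End Parametrized.

(* "for generic symmetric S": on a nonempty principal Zariski open subset of
   the space of symmetric matrices *)
Definition generic_symmetric (Q : 'M[F]_m -> Prop) : Prop :=
  exists f : {mpoly F[m * m]},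
    (exists S, symmetric_mx S /\ f.@[mxvec S 0] != 0) /\
    (forall S, symmetric_mx S -> f.@[mxvec S 0] != 0 -> Q S).

(* M has maximum likelihood degree d; the number of critical points does not
   depend on the basis K of M. *)
Definition ml_degree M (d : nat) : Prop :=
  exists (N : nat) (K : N.-tuple 'M[F]_m), parametrizes K M /\
    generic_symmetric (fun S =>
      exists s : seq 'rV[F]_N,
        [/\ uniq s, size s = d & forall x, x \in s <-> critical_point K S x]).

End MLDegree.

(* Main.v *)
Require Import Defs.
From mathcomp Require Import fintype finset fingroup perm.
From mathcomp Require Import ring.

(** The logarithmic derivative of P_G with respect to x_e is the effective
    resistance across e in the network with conductances x, so both claims say
    that generic resistances on the edges of G come from a unique network, which
    depends rationally on them.  A chordal graph is built from a point by
    successively adding a vertex v whose neighbours form a nonempty clique Q.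
    Eliminating v by the star-mesh transformation changes only the conductances
    inside Q and preserves the resistances between the other vertices, so the
    induction hypothesis gives the reduced network; the conductances z_q d of the
    star at v (with z summing to 1) then solve the linear system S z - c 1 = b,
    where S and b are the resistances inside Q and from v to Q, and
    2 / d = z.b - c.  All the nondegeneracy conditions hold when all resistances
    are 1.  The inverse of the gradient map is the homogenisation of this
    rational inverse, and P_G is the determinant of the reduced Laplacian by the
    matrix-tree theorem. *)

Set Implicit Arguments.
Unset Strict Implicit.
Unset Printing Implicit Defensive.
Import Order.TTheory GRing.Theory Num.Theory.

(** * Chordal graphs *)

(** Chordality acts in two ways when a vertex [v] is added. Eliminating [v] creates conductances
    between all pairs of its neighbours; as these form a clique, the new conductances sit on edges
    of G, so the reduced network lives on the smaller graph. Moreover every entry of S is then a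
    prescribed resistance, so the system for the star involves the data alone and not the still
    unknown reduced network. That system is row v of L R = 2 (tau 1^T - 1) divided by d, with c = -
    2 tau_v / d, and the formula for 2 / d is the entry (v, v) of the same identity. The factor 2
    comes from R_ij = G_ii + G_jj - 2 G_ij, with G the inverse of a reduced Laplacian. The step is
    proved in both directions: extending a network gives existence, and the fact that every larger
    network arises by extension gives uniqueness. Uniqueness yields exactly one critical point, and
    identifies x, up to a scalar, with the value of the inverse map at the gradient of P_G at x. *)

Lemma shortest_path (T : finType) (e : rel T) (x y : T) :
  connect e x y ->
  exists p, [/\ path e x p, last x p = y, uniq (x :: p) &
    forall q, path e x q -> last x q = y -> size p <= size q]%N.
Proof.
move=> /connectP [p0 ep0 yE].
pose P m := [exists p : m.-tuple T, path e x p && (last x p == y)].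
have exP : exists m, P m.
  exists (size p0); apply/existsP; exists (in_tuple p0).
  by rewrite ep0 -yE eqxx.
case: (ex_minnP exP) => m /existsP [p /andP [ep /eqP ly]] minm.
have minq q : path e x q -> last x q = y -> (m <= size q)%N.
  move=> eq lq; apply: minm; apply/existsP; exists (in_tuple q).
  by rewrite eq lq eqxx.
move: ly; case/shortenP: ep => p' ep' up' sub ly.
exists p'; split=> // q eq lq; apply: leq_trans (minq q eq lq).
rewrite -(size_tuple p); apply: uniq_leq_size sub.
by case/andP: up'.
Qed.

(** An edge from position [i] to position [j] would give a path of length i + 1 + (size p - j), so
    minimality forces j <= i + 1. *)
Lemma shortest_path_induced (T : finType) (e : rel T) (x : T) p i j :
  path e x p ->
  (forall q, path e x q -> last x q = last x p -> size p <= size q)%N ->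
  (i < j <= size p)%N -> e (nth x (x :: p) i) (nth x (x :: p) j) -> j = i.+1.
Proof.
move=> ep minp /andP [ij jp] eij; apply/eqP; rewrite eqn_leq ij andbT.
have lastt k : (k <= size p)%N -> last x (take k p) = nth x (x :: p) k.
  case: k => [|k] kp /=; first by rewrite take0.
  by rewrite (take_nth x kp) last_rcons.
have ip : (i <= size p)%N by apply: leq_trans (ltnW ij) jp.
have := minp (take i p ++ nth x (x :: p) j :: drop j p).
have epij k : path e x p = path e x (take k p) && path e (last x (take k p)) (drop k p).
  by rewrite -cat_path cat_take_drop.
move: (ep) (ep); rewrite {1}(epij j) (epij i) => /andP [_ epj] /andP [epi _].
rewrite cat_path epi /= lastt // eij /= -lastt // epj last_cat /= => /(_ isT).
rewrite -last_cat cat_take_drop => /(_ erefl).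
rewrite size_cat /= size_takel // size_drop => minij.
by rewrite -(leq_add2r (size p - j)) subnKC // addSn -addnS.
Qed.

Section Chordal.
Variables (n : nat) (g : rel 'I_n).
Hypotheses (gsym : ssrbool.symmetric g) (girr : irreflexive g) (gch : chordal g).
Implicit Types (A B Q U X : {set 'I_n}).

Definition clique Q : Prop := {in Q &, forall i j, i != j -> g i j}.

Definition nbrs U v := [set u in U | g v u].

Definition restrict A : rel 'I_n := [rel x y | [&& x \in A, y \in A & g x y]].

Lemma restrict_connect_sym A : connect_sym (restrict A).
Proof.
by apply: sym_connect_sym => x y; rewrite /restrict /= gsym andbCA.
Qed.

Lemma connect_restrictS A B : A \subset B ->
  subrel (connect (restrict A)) (connect (restrict B)).
Proof.
move=> /subsetP AB; apply: connect_sub => x y /and3P [xA yA gxy].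
by apply: connect1; rewrite /restrict /= !AB.
Qed.

(* An induced path through A from s to t would close up, through w, to a
   chordless cycle. *)
Lemma chordal_connected_common_neighbor A s t w :
  {in A &, forall x y, connect (restrict A) x y} ->
  {in A, forall x, ~~ g w x} -> w \notin A ->
  (exists2 x, x \in A & g s x) -> (exists2 x, x \in A & g t x) ->
  g w s -> g w t -> s != t -> g s t.
Proof.
move=> Ac wA wnA [x xA gsx] [y yA gty] gws gwt st.
case gst : (g s t) => //; exfalso.
pose B := s |: (t |: A).
have AB : A \subset B by apply/subsetP=> z zA; rewrite !inE zA !orbT.
have [sB tB] : s \in B /\ t \in B by rewrite !inE !eqxx !orbT.
(* A shortest path inside [B] is induced, and has length at least 2 if [s] and [t] are not adjacent;
   closing it through [w] gives a cycle with at least four vertices. *)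
have /shortest_path [p [ep lp up minp]] : connect (restrict B) s t.
  apply: connect_trans (_ : connect _ x t).
    by apply: connect1; rewrite /restrict /= sB (subsetP AB).
  apply: connect_trans (connect_restrictS AB (Ac _ _ xA yA)) _.
  by apply: connect1; rewrite /restrict /= tB (subsetP AB) //= gsym.
have pB : {subset s :: p <= B}.
  move: ep sB; elim: (p) (s) => [|z q IH] r /=; first by move=> _ rB u; rewrite inE => /eqP ->.
  move=> /andP [/and3P [_ zB _] /IH {}IH] rB u; rewrite inE => /predU1P [-> //|].
  exact: IH.
have wB : w \notin B.
  rewrite !inE !negb_or wnA andbT; apply/andP; split.
    by apply: contraTneq gws => ->; rewrite girr.
  by apply: contraTneq gwt => ->; rewrite girr.
have adjw z : z \in s :: p -> g w z -> z = s \/ z = t.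
  move=> /pB; rewrite !inE => /or3P [/eqP|/eqP|zA]; [by left|by right|].
  by rewrite (negPf (wA z zA)).
have wp : w \notin s :: p by apply: contra wB; apply: pB.
have gp : path g s p by apply: sub_path ep => ? ? /and3P [].
have sp : (2 <= size p)%N.
  case: (p) lp gp => [/= e _|z [|? ?]] //=; first by rewrite e eqxx in st.
  by move=> ->; rewrite gst.
pose c := w :: s :: p.
have uc : ucycle g c.
  rewrite /ucycle /c cons_uniq wp up andbT /path.cycle rcons_path /= gws gp /=.
  by rewrite lp gsym gwt.
have nextw : next c w = s by rewrite /c /= eqxx.
(* The default value [w] covers k = size p: the successor of the last vertex [t] is [w]. *)
have nextc k : (k <= size p)%N -> next c (nth s (s :: p) k) = nth w p k.
  move=> kp; have km : nth s (s :: p) k \in s :: p by rewrite mem_nth.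
  rewrite next_nth /c inE km orbT /=.
  case: eqP => [e|_] /=; first by rewrite e km in wp.
  case: k kp km => [|k] kp km /=; first by rewrite eqxx.
  case: eqP => [e|_] /=.
    by move: up; rewrite /= e mem_nth.
  by rewrite index_uniq //; case/andP: up.
have [i [j [ic jc gij jni inj]]] := gch uc sp.
(* A chord at [w] could only end at [s] or [t], the two vertices next to [w] on the cycle. *)
have wend z : z \in s :: p -> g w z -> z != next c w -> w != next c z -> False.
  move=> zp gwz; rewrite nextw; case: (adjw z zp gwz) => ->; rewrite ?eqxx // => _.
  by rewrite -lp -nth_last -[nth _ p _]/(nth s (s :: p) (size p).-1.+1)
    prednK ?(ltnW sp) // nextc // nth_default // eqxx.
have idx z : z \in s :: p -> exists2 k, (k <= size p)%N & z = nth s (s :: p) k.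
  by move=> zp; exists (index z (s :: p)); rewrite ?nth_index // -ltnS index_mem.
have key k l : (k < l <= size p)%N -> g (nth s (s :: p) k) (nth s (s :: p) l) ->
    nth s (s :: p) l != next c (nth s (s :: p) k) -> False.
  move=> kl gkl; have /andP [lk lp'] := kl.
  rewrite nextc; last by apply: leq_trans (ltnW lk) lp'.
  rewrite (@shortest_path_induced _ _ s p k l ep _ kl).
  - rewrite /= (set_nth_default w) ?eqxx //.
    by apply: leq_trans lk lp'.
  - by rewrite lp.
  - rewrite /restrict /= gkl andbT; apply/andP; split; apply: pB; apply: mem_nth => //.
    by rewrite ltnS; apply: leq_trans (ltnW lk) lp'.
move: ic jc; rewrite !(inE) -!(in_cons s p) => /predU1P [iw|ip] /predU1P [jw|jp].
- by rewrite iw jw girr in gij.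
- by rewrite iw in gij jni inj; apply: (wend j).
- by rewrite jw gsym in gij; rewrite jw in jni inj; apply: (wend i).
have [k kp iE] := idx i ip; have [l lp' jE] := idx j jp; rewrite {}iE {}jE in gij jni inj.
case: (ltngtP k l) => kl.
- by apply: (key k l); rewrite ?kl.
- by apply: (key l k); rewrite ?kl // gsym.
- by rewrite kl girr in gij.
Qed.

(** Dirac's argument. If [U] is not complete, take a maximal connected [A] around [a] that still
    leaves a far vertex, one outside [A] with no neighbour in [A]. Its boundary [S] is then a clique
    joined to every vertex of the set [W] of far vertices, so a simplicial vertex of the smaller set
    [W] is simplicial in [U]. *)
Lemma chordal_simplicial U : U != set0 -> exists2 v, v \in U & clique (nbrs U v).
Proof.
have [m] := ubnP #|U|; elim: m U => // m IH U /ltnSE Um /set0Pn [u0 u0U].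
have [/'forall_forallP cU|] := boolP [forall a, forall b, (a \in U) && (b \in U) ==> (a == b) || g a b].
  exists u0 => // i j; rewrite !inE => /andP [iU _] /andP [jU _] ij.
  by have := cU i j; rewrite iU jU (negPf ij).
rewrite negb_forall => /existsP [a]; rewrite negb_forall => /existsP [b].
rewrite negb_imply negb_or => /andP [/andP [aU bU] /andP [ab gab]].
pose far A w := (w \notin A) && [forall x in A, ~~ g w x].
pose good A := [&& a \in A, A \subset U,
  [forall x in A, connect (restrict A) a x] & [exists w in U, far A w]].
have good1 : good [set a].
  rewrite /good set11 sub1set aU /=; apply/andP; split.
    by apply/'forall_implyP=> x /set1P ->.
  apply/existsP; exists b; rewrite bU /far inE eq_sym ab /=.
  by apply/'forall_implyP=> x /set1P ->; rewrite gsym.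
have [A /maxsetP [/and4P [aA AU Ac /existsP [w0 /andP [w0U w0A]]] maxA] _] := maxset_exists good1.
have {}Ac : {in A &, forall x y, connect (restrict A) x y}.
  move=> x y xA yA; apply: (@connect_trans _ _ a).
    by rewrite restrict_connect_sym; move/'forall_implyP: Ac; apply.
  by move/'forall_implyP: Ac; apply.
pose W := [set w in U | far A w].
pose S := [set s in U | (s \notin A) && [exists x in A, g s x]].
(* If [s] missed [w], then [s |: A] would still be connected with [w] far from it, against
   maximality. *)
have SW s w : s \in S -> w \in W -> g s w.
  rewrite !inE => /and3P [sU sA /existsP [x /andP [xA gsx]]] /and3P [wU wA /'forall_implyP wfar].
  apply: contraTT sA => gsw; rewrite negbK.
  have sws : s != w by apply: contraTneq gsx => ->; apply: wfar.
  rewrite -(maxA (s |: A)) ?subsetUr ?setU11 //.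
  have sAA : A \subset s |: A by apply: subsetUr.
  rewrite /good !inE aA orbT subUset sub1set sU AU /=; apply/andP; split.
    apply/'forall_implyP=> y; rewrite inE => /orP [/set1P ->|yA]; last first.
      by apply: (connect_restrictS sAA); apply: Ac.
    apply: (@connect_trans _ _ x); first by apply: (connect_restrictS sAA); apply: Ac.
    by apply: connect1; rewrite /restrict /= !inE xA eqxx orbT /= gsym.
  apply/existsP; exists w; rewrite wU /far !inE negb_or wA eq_sym sws /=.
  by apply/'forall_implyP=> y /setU1P [->|/wfar //]; rewrite gsym.
have w0W : w0 \in W by rewrite !inE w0U.
have Scl : clique S.
  move=> s t sS tS st.
  move: (w0W) (sS) (tS); rewrite !inE => /and3P [_ wA /'forall_implyP wfar].
  move=> /and3P [_ _ /existsP [x /andP [xA gsx]]] /and3P [_ _ /existsP [y /andP [yA gty]]].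
  apply: (@chordal_connected_common_neighbor A s t w0) => //.
  - by exists x.
  - by exists y.
  - by rewrite gsym SW.
  - by rewrite gsym SW.
have WU : W \subset U by apply/subsetP=> z; rewrite inE => /andP [].
have W0 : W != set0 by apply/set0Pn; exists w0.
have [|v vW vcl] := IH W _ W0.
  apply: leq_trans Um; apply: proper_card; rewrite properE WU.
  by apply/subsetPn; exists a; rewrite // !inE /far aA andbF.
exists v; first exact: (subsetP WU).
have vN i : i \in nbrs U v -> i \in S \/ i \in nbrs W v.
  rewrite inE => /andP [iU gvi]; move: (vW); rewrite inE => /and3P [vU vA /'forall_implyP vfar].
  have iA : i \notin A by apply: contraL gvi; apply: vfar.
  case: (boolP [exists x in A, g i x]) => [ix|]; first by left; rewrite inE iU iA.
  rewrite negb_exists => /forallP inx; right; rewrite !inE iU gvi /far iA andbT /=.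
  by apply/'forall_implyP=> x xA; have := inx x; rewrite xA.
have NW i : i \in nbrs W v -> i \in W by rewrite inE => /andP [].
move=> i j /vN [iS|iW] /vN [jS|jW] ij.
- exact: Scl.
- by apply: SW => //; apply: NW.
- by rewrite gsym; apply: SW => //; apply: NW.
- exact: vcl.
Qed.

(** A perfect elimination ordering read backwards; the nonempty neighbourhoods account for
    connectedness. *)
Inductive elimination_ordered : {set 'I_n} -> Prop :=
| Elim_single v : elimination_ordered [set v]
| Elim_add U v : elimination_ordered U -> v \notin U ->
    nbrs U v != set0 -> clique (nbrs U v) -> elimination_ordered (v |: U).

(** Connectedness of the graph induced on [U], stated by cuts so that a vertex can be removed
    without rerouting paths. *)
Definition cut_connected U : Prop := forall X, X \subset U -> X != set0 ->
  X != U -> exists x y, [/\ x \in X, y \in U :\: X & g x y].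

Lemma cut_connectedT : connected_graph g -> cut_connected setT.
Proof.
move=> gcon X _ /set0Pn [x xX] XT.
have [y] : exists y, y \notin X.
  by apply/existsP; rewrite -negb_forall; apply: contra XT => /forallP XT;
    apply/eqP/setP=> z; rewrite XT inE.
have /connectP [p] := gcon x y.
elim: p x xX => [|z p IH] x xX /=; first by move=> _ ->; rewrite xX.
move=> /andP [gxz pz] yl yX; case zX : (z \in X); first exact: (IH z).
by exists x, z; rewrite !inE zX.
Qed.

(** If the edge leaving [X] ends at [v], take an edge leaving [v |: X]. When that one starts at [v],
    the ends of the two edges other than [v] are both neighbours of [v], hence adjacent. *)
Lemma cut_connectedD1 U v : cut_connected U -> v \in U ->
  clique (nbrs U v) -> cut_connected (U :\ v).
Proof.
move=> Uc vU vcl X XU X0 XD.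
have /andP [XU' vX] : (X \subset U) && (v \notin X).
  by move: XU; rewrite subsetD1.
have [|x [y [xX]]] := Uc X XU' X0; first by apply: contraNneq vX => ->.
rewrite inE => /andP [yX yU] gxy.
case: (eqVneq y v) => [yv|yv]; last by exists x, y; rewrite !inE yv yX yU.
have [|||z [t [zX]]] := Uc (v |: X).
- by rewrite subUset sub1set vU.
- by apply/set0Pn; exists v; apply: setU11.
- apply: contraNneq XD => <-; apply/eqP/setP=> r; rewrite !inE.
  by case: eqP => [->|] //=; apply/negbTE.
rewrite !inE negb_or => /andP [/andP [tv tX] tU] gzt.
move: zX; rewrite inE => /orP [/set1P zv|zX]; last by exists z, t; rewrite !inE tv tX tU.
exists x, t; rewrite !inE tv tX tU; split=> //; apply: vcl; rewrite ?inE.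
- by rewrite (subsetP XU') // -yv gsym.
- by rewrite tU -zv.
- by apply: contraNneq tX => <-.
Qed.

Lemma chordal_elimination_ordered U :
  U != set0 -> cut_connected U -> elimination_ordered U.
Proof.
have [m] := ubnP #|U|; elim: m U => // m IH U /ltnSE Um U0 Uc.
have [v vU vcl] := chordal_simplicial U0.
case: (eqVneq U [set v]) => [->|Uv]; first exact: Elim_single.
have UD : U :\ v != set0.
  by apply: contra Uv; rewrite setD_eq0 subset1 (negPf U0) orbF.
have nbE : nbrs (U :\ v) v = nbrs U v.
  by apply/setP=> x; rewrite !inE; case: eqP => [->|] //=; rewrite girr andbF.
rewrite -(setD1K vU); apply: Elim_add; rewrite ?nbE ?setD11 //.
- apply: IH UD (cut_connectedD1 Uc vU vcl).
  by apply: leq_trans Um; rewrite [X in (_ < X)%N](cardsD1 v) vU.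
have [|||x [y [/set1P -> yU gvy]]] := Uc [set v].
- by rewrite sub1set.
- by apply/set0Pn; exists v; apply: set11.
- by rewrite eq_sym.
by apply/set0Pn; exists y; move: yU; rewrite !inE gvy => /andP [_ ->].
Qed.

End Chordal.

(** * Generic points and rational functions *)

Local Open Scope ring_scope.

Section ZariskiDensity.
Variable F : numFieldType.

Lemma poly_eval_eq0 (p : {poly F}) : (forall t, p.[t] = 0) -> p = 0.
Proof.
move=> p0; apply: (@roots_geq_poly_eq0 _ _ [seq i%:R | i <- iota 0 (size p)]).
- by apply/allP=> t _; apply/rootP.
- by rewrite map_inj_uniq ?iota_uniq // => i j /eqP; rewrite eqr_nat => /eqP.
- by rewrite size_map size_iota.
Qed.

(** A monomial is determined by its last exponent together with the others, so [muni], which singles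
    out the last variable, loses no coefficient. *)
Lemma muni_coef n (p : {mpoly F[n.+1]}) (m : 'X_{1..n.+1}) :
  ((muni p)`_(m ord_max))@_[multinom m (widen_ord (leqnSn n) i) | i < n] = p@_m.
Proof.
pose r (m : 'X_{1..n.+1}) : 'X_{1..n} := [multinom m (widen_ord (leqnSn n) i) | i < n].
have rP m1 m2 : (r m1 == r m2) && (m1 ord_max == m2 ord_max) = (m1 == m2).
  apply/andP/eqP=> [[/eqP/mnmP e1 /eqP e2]|-> //]; apply/mnmP=> i.
  case: (unliftP ord_max i) => [j ->|-> //]; have := e1 j; rewrite !mnmE.
  suff -> : lift ord_max j = widen_ord (leqnSn n) j by [].
  by apply: val_inj; rewrite /= /bump leqNgt ltn_ord.
rewrite muniE coef_sum raddf_sum /=.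
have termE (m' : 'X_{1..n.+1}) : ((p@_m' *: 'X_[r m'] *: 'X^(m' ord_max) : {poly {mpoly F[n]}})`_(m ord_max))@_(r m)
    = p@_m' * (m' == m)%:R.
  rewrite coefZ coefXn mulr_natr raddfMn /= mcoeffZ mcoeffX -mulrnAr -mulrnA mulnb.
  by rewrite [m ord_max == _]eq_sym rP.
under eq_bigr => m' _ do rewrite termE.
have [mp|mp] := boolP (m \in msupp p).
  rewrite (bigD1_seq m) ?msupp_uniq //= eqxx mulr1 big1 ?addr0 // => m' /negPf ->.
  by rewrite mulr0.
rewrite memN_msupp_eq0 // big_seq big1 // => m' m'p.
by rewrite (_ : m' == m = false) ?mulr0 //; apply: contraNF mp => /eqP <-.
Qed.

Lemma mpoly_eval_eq0 n (p : {mpoly F[n]}) : (forall v, p.@[v] = 0) -> p = 0.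
Proof.
elim: n p => [|n IH] p p0.
  apply/mpolyP=> m; have /= := p0 (fun=> 0); rewrite mevalE mcoeff0.
  have m0 (m' : 'X_{1..0}) : m' = m by apply/mnmP=> -[].
  have -> : \sum_(m' <- msupp p) p@_m' * \prod_(i < 0) 0 ^+ m' i = \sum_(m' <- msupp p) p@_m'.
    by apply: eq_bigr => m' _; rewrite big_ord0 mulr1.
  have [mp|mp _] := boolP (m \in msupp p); last by rewrite memN_msupp_eq0.
  by rewrite (bigD1_seq m) ?msupp_uniq //= big1 ?addr0 // => i; rewrite (m0 i) eqxx.
suff mu0 : muni p = 0.
  by apply/mpolyP=> m; rewrite -muni_coef mu0 coef0 !mcoeff0.
apply/polyP=> k; rewrite coef0; apply: IH => v.
have -> : ((muni p)`_k).@[v] = (map_poly (meval v) (muni p))`_k by rewrite coef_map.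
suff -> : map_poly (meval v) (muni p) = 0 by rewrite coef0.
apply: poly_eval_eq0 => t.
pose u (i : 'I_n.+1) := if unlift ord_max i is Some j then v j else t.
rewrite -[RHS](p0 u) mevalE muniE rmorph_sum horner_sum; apply: eq_bigr => m _.
rewrite /= map_polyZ /= map_polyXn hornerZ hornerXn mevalZ mevalX -mulrA big_ord_recr /=.
rewrite /u unlift_none; congr (_ * (_ * _)); apply: eq_bigr => i _.
rewrite mnmE (_ : widen_ord _ i = lift ord_max i) ?liftK //.
by apply: val_inj; rewrite /= /bump leqNgt ltn_ord.
Qed.

Lemma mpoly_eval_neq0 n (p : {mpoly F[n]}) :
  p != 0 -> exists x : 'rV[F]_n, p.@[x 0] != 0.
Proof.
move=> p0; apply: contrapT => nx; case/eqP: p0; apply: mpoly_eval_eq0 => v.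
apply: contrapT => /eqP pv; apply: nx; exists (\row_i v i).
by rewrite (@meval_eq _ _ _ v) // => i; rewrite mxE.
Qed.

Lemma mpoly_eq_dense n (h p q : {mpoly F[n]}) (x0 : 'rV[F]_n) :
  h.@[x0 0] != 0 -> (forall x : 'rV_n, h.@[x 0] != 0 -> p.@[x 0] = q.@[x 0]) ->
  p = q.
Proof.
move=> hx0 pq; have h0 : h != 0 by apply: contraNneq hx0 => ->; rewrite meval0.
suff : (p - q) * h == 0 by rewrite mulf_eq0 (negPf h0) orbF subr_eq0 => /eqP.
apply: contrapT => /negP /mpoly_eval_neq0 [x]; rewrite mevalM mevalB.
by have [->|/pq ->] := eqVneq (h.@[x 0]) 0; rewrite ?mulr0 ?subrr ?mul0r eqxx.
Qed.

End ZariskiDensity.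

(** * Rational functions regular at the all-ones point *)

Section Rational.
Variables (F : numFieldType) (N : nat).
Implicit Types (s : 'rV[F]_N) (f h : {mpoly F[N]}) (u v : 'rV[F]_N -> F)
  (Q : 'rV[F]_N -> Prop).

Definition ones : 'rV[F]_N := const_mx 1.

(* All the genericity conditions of the proof hold at the all-ones point; asking
   for this makes them compatible with each other for free. *)
Definition generic Q : Prop :=
  exists2 f, f.@[ones 0] != 0 & forall s, f.@[s 0] != 0 -> Q s.

(** [u] is unconstrained where [h] vanishes, so conventional values such as 0^-1 = 0 do no harm. *)
Definition rational u : Prop :=
  exists f h, h.@[ones 0] != 0 /\
    forall s, h.@[s 0] != 0 -> u s = f.@[s 0] / h.@[s 0].

Lemma genericT Q : (forall s, Q s) -> generic Q.
Proof. by exists 1 => //; rewrite meval1 oner_neq0. Qed.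

Lemma genericI Q1 Q2 : generic Q1 -> generic Q2 -> generic (fun s => Q1 s /\ Q2 s).
Proof.
move=> [f1 f11 h1] [f2 f21 h2]; exists (f1 * f2).
  by rewrite mevalM mulf_neq0.
by move=> s; rewrite mevalM mulf_eq0 negb_or => /andP [/h1 ? /h2 ?].
Qed.

Lemma generic_sub Q1 Q2 : (forall s, Q1 s -> Q2 s) -> generic Q1 -> generic Q2.
Proof. by move=> Q12 [f f1 fQ]; exists f => // s /fQ /Q12. Qed.

Lemma rational_ext u v : u =1 v -> rational u -> rational v.
Proof. by move=> uv [f [h [h1 uE]]]; exists f, h; split=> // s; rewrite -uv; apply: uE. Qed.

Lemma rational_poly f : rational (fun s => f.@[s 0]).
Proof. by exists f, 1; split=> [|s _]; rewrite meval1 ?oner_neq0 // divr1. Qed.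

Lemma rational_cst c : rational (fun=> c).
Proof. by apply: rational_ext (rational_poly c%:MP) => s; rewrite mevalC. Qed.

Lemma rationalD u v : rational u -> rational v -> rational (fun s => u s + v s).
Proof.
move=> [f [h [h1 uE]]] [f' [h' [h1' vE]]].
exists (f * h' + f' * h), (h * h'); split; first by rewrite mevalM mulf_neq0.
move=> s; rewrite mevalM mulf_eq0 negb_or => /andP [hs hs'].
by rewrite uE // vE // mevalD !mevalM addf_div.
Qed.

Lemma rationalM u v : rational u -> rational v -> rational (fun s => u s * v s).
Proof.
move=> [f [h [h1 uE]]] [f' [h' [h1' vE]]].
exists (f * f'), (h * h'); split; first by rewrite mevalM mulf_neq0.
move=> s; rewrite mevalM mulf_eq0 negb_or => /andP [hs hs'].
by rewrite uE // vE // mevalM mulf_div.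
Qed.

Lemma rationalN u : rational u -> rational (fun s => - u s).
Proof.
by move=> ur; apply: rational_ext (rationalM (rational_cst (-1)) ur) => s; rewrite mulN1r.
Qed.

Lemma rationalV u : rational u -> u ones != 0 -> rational (fun s => (u s)^-1).
Proof.
move=> [f [h [h1 uE]]]; rewrite uE // mulf_eq0 negb_or => /andP [f1 _].
exists (h * h), (f * h); split; first by rewrite mevalM mulf_neq0.
move=> s; rewrite mevalM mulf_eq0 negb_or => /andP [fs hs].
by rewrite uE // !mevalM invf_div -mulf_div divff // mulr1.
Qed.

Lemma rational_sum (I : Type) (r : seq I) (P : pred I) (u : I -> 'rV[F]_N -> F) :
  (forall i, P i -> rational (u i)) -> rational (fun s => \sum_(i <- r | P i) u i s).
Proof.
move=> ur; elim: r => [|i r IH].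
  by apply: rational_ext (rational_cst 0) => s; rewrite big_nil.
case Pi : (P i); last by apply: rational_ext IH => s; rewrite big_cons Pi.
by apply: rational_ext (rationalD (ur i Pi) IH) => s; rewrite big_cons Pi.
Qed.

Lemma rational_prod (I : Type) (r : seq I) (P : pred I) (u : I -> 'rV[F]_N -> F) :
  (forall i, P i -> rational (u i)) -> rational (fun s => \prod_(i <- r | P i) u i s).
Proof.
move=> ur; elim: r => [|i r IH].
  by apply: rational_ext (rational_cst 1) => s; rewrite big_nil.
case Pi : (P i); last by apply: rational_ext IH => s; rewrite big_cons Pi.
by apply: rational_ext (rationalM (ur i Pi) IH) => s; rewrite big_cons Pi.
Qed.

Lemma rational_det m (A : 'rV[F]_N -> 'M[F]_m) :
  (forall i j, rational (fun s => A s i j)) -> rational (fun s => \det (A s)).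
Proof.
move=> Ar; apply: rational_sum => p _; apply: rationalM; first exact: rational_cst.
by apply: rational_prod => i _; apply: Ar.
Qed.

(** Cramer's rule: cofactors are determinants, so the only division is by [\det (A s)]. *)
Lemma rational_solve m (A : 'rV[F]_N -> 'M[F]_m) (b : 'rV[F]_N -> 'cV[F]_m) :
  (forall i j, rational (fun s => A s i j)) -> (forall i, rational (fun s => b s i 0)) ->
  \det (A ones) != 0 ->
  forall i, rational (fun s => ((\det (A s))^-1 *: (\adj (A s) *m b s)) i 0).
Proof.
move=> Ar br A1 i.
apply: (@rational_ext (fun s => (\det (A s))^-1 * \sum_j \adj (A s) i j * b s j 0)).
  by move=> s; rewrite !mxE.
apply: rationalM; first by apply: rationalV A1; apply: rational_det.
apply: rational_sum => j _; apply: rationalM; last exact: br.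
apply: (@rational_ext (fun s => cofactor (A s) j i)); first by move=> s; rewrite !mxE.
apply: rationalM; first exact: rational_cst.
apply: rational_det => i' j'.
apply: (@rational_ext (fun s => A s (lift j i') (lift i j'))); last exact: Ar.
by move=> s; rewrite !mxE.
Qed.

Lemma generic_neq0 u : rational u -> u ones != 0 -> generic (fun s => u s != 0).
Proof.
move=> [f [h [h1 uE]]]; rewrite uE // mulf_eq0 negb_or => /andP [f1 _].
exists (f * h); first by rewrite mevalM mulf_neq0.
move=> s; rewrite mevalM mulf_eq0 negb_or => /andP [fs hs].
by rewrite uE // mulf_neq0 ?invr_neq0.
Qed.

End Rational.

(** * Star-mesh transformation *)

Lemma set2_inj (T : finType) (i j k l : T) : [set i; j] = [set k; l] ->
  (i = k /\ j = l) \/ (i = l /\ j = k).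
Proof.
move=> e; have /set2P ikl : i \in [set k; l] by rewrite -e set21.
have /set2P jkl : j \in [set k; l] by rewrite -e set22.
have /set2P kij : k \in [set i; j] by rewrite e set21.
have /set2P lij : l \in [set i; j] by rewrite e set22.
by intuition congruence.
Qed.

Section EdgeWeight.
Variables (n : nat) (g : rel 'I_n).
Hypothesis gsym : ssrbool.symmetric g.

Lemma edge_val_adj (a : 'I_#|edges g|) i j : enum_val a = [set i; j] -> g i j.
Proof.
move=> ae; have := enum_valP a; rewrite inE => /existsP [k /existsP [l]].
rewrite ae => /andP [gkl /eqP /set2_inj [[-> ->]|[-> ->]]] //.
by rewrite gsym.
Qed.

Lemma edge_valP (a : 'I_#|edges g|) : exists i j, g i j /\ enum_val a = [set i; j].
Proof.
have := enum_valP a; rewrite inE => /existsP [k /existsP [l /andP [gkl /eqP]]].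
by exists k, l.
Qed.

Lemma edge_index i j : g i j -> exists a : 'I_#|edges g|, enum_val a = [set i; j].
Proof.
move=> gij; have eij : [set i; j] \in edges g.
  by rewrite inE; apply/existsP; exists i; apply/existsP; exists j; rewrite gij eqxx.
by exists (enum_rank_in eij [set i; j]); rewrite enum_rankK_in.
Qed.

Variable F : fieldType.
Implicit Types x : 'rV[F]_#|edges g|.

Lemma edge_weightC x i j : edge_weight x i j = edge_weight x j i.
Proof. by rewrite /edge_weight setUC. Qed.

Lemma edge_weight_eq x a i j : enum_val a = [set i; j] -> edge_weight x i j = x 0 a.
Proof.
move=> ae; rewrite /edge_weight (bigD1 a) /= ?ae // big1 ?addr0 // => b /andP [/eqP bE].
by rewrite (_ : b = a) ?eqxx //; apply: enum_val_inj; rewrite ae.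
Qed.

Lemma edge_weight_eq0 x i j : ~~ g i j -> edge_weight x i j = 0.
Proof.
move=> gij; rewrite /edge_weight big1 // => a /eqP /edge_val_adj.
by rewrite (negPf gij).
Qed.

End EdgeWeight.

Section StarMesh.
Variables (n : nat) (g : rel 'I_n).
Hypotheses (gsym : ssrbool.symmetric g) (girr : irreflexive g).
Variable F : numFieldType.
Implicit Types (w R : 'I_n -> 'I_n -> F) (U : {set 'I_n}) (tau : 'I_n -> F)
  (s : 'rV[F]_#|edges g|).

Definition weight_on U w : Prop := (forall i j, w i j = w j i) /\
  (forall i j, ~~ [&& i \in U, j \in U & g i j] -> w i j = 0).

(* L R = 2 (tau 1^T - 1), where L is the Laplacian of w: this says that R is the
   matrix of effective resistances of the network w. *)
Definition resistance_eq U w R tau : Prop := {in U &, forall i j,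
  \sum_l w i l * (R i j - R l j) = 2 * (tau i - (i == j)%:R)}.

Definition resistance U w R : Prop :=
  [/\ forall i j, R i j = R j i, forall i, R i i = 0 & exists tau, resistance_eq U w R tau].

(** Only resistances across edges are prescribed. The same [s], indexed by all edges of G, serves
    for every [U], so the data stay fixed during the induction. *)
Definition has_resistances U s w : Prop := weight_on U w /\
  exists2 R, resistance U w R &
    {in U &, forall i j, g i j -> R i j = edge_weight s i j}.

Definition unique_network U s w : Prop := has_resistances U s w /\
  forall w', has_resistances U s w' -> forall i j, w' i j = w i j.

(** * Adding one simplicial vertex *)

Section Step.
Variables (U : {set 'I_n}) (v : 'I_n).
Hypotheses (vU : v \notin U) (Qcl : clique g (nbrs g U v)).
Let Q := nbrs g U v.

Let vQ : v \notin Q.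
Proof. by rewrite inE (negPf vU). Qed.

Let QU i : i \in Q -> i \in U.
Proof. by rewrite inE => /andP []. Qed.

Let Uv i : i \in U -> i != v.
Proof. by apply: contraTneq => ->. Qed.

(* The star at v is found from the resistances s by solving S z - c 1 = b,
   1.z = 1, where S and b are the resistances inside Q and from v to Q.  The
   index v, which is not in Q, serves for the unknown c and for the equation
   1.z = 1. *)
Definition star_mx s : 'M[F]_n := \matrix_(i, j)
  if i == v then (j \in Q)%:R
  else if i \in Q then
    if j \in Q then edge_weight s i j else - (j == v)%:R
  else (i == j)%:R.

Definition star_rhs s : 'cV[F]_n := \col_i
  if i == v then 1 else if i \in Q then edge_weight s v i else 0.

Definition star_sol s : 'cV[F]_n :=
  (\det (star_mx s))^-1 *: (\adj (star_mx s) *m star_rhs s).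

Lemma star_mx_mulE s (z : 'cV[F]_n) i : (star_mx s *m z) i 0 =
  if i == v then \sum_(j in Q) z j 0
  else if i \in Q then \sum_(j in Q) edge_weight s i j * z j 0 - z v 0
  else z i 0.
Proof.
rewrite mxE; case: eqP => [->|/eqP iv].
  by rewrite [RHS]big_mkcond; apply: eq_bigr => j _; rewrite mxE eqxx; case: ifP;
    rewrite ?mul1r ?mul0r.
case iQ : (i \in Q).
  rewrite [RHS]addrC [in RHS]big_mkcond (bigD1 v) //= [in RHS](bigD1 v) //=.
  rewrite mxE (negPf iv) iQ (negPf vQ) eqxx mulN1r add0r; congr (_ + _).
  apply: eq_bigr => j jv; rewrite mxE (negPf iv) iQ (negPf jv).
  by case: ifP => //; rewrite oppr0 mul0r.
rewrite (bigD1 i) //= mxE (negPf iv) iQ eqxx mul1r big1 ?addr0 // => j ji.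
by rewrite mxE (negPf iv) iQ eq_sym (negPf ji) mul0r.
Qed.

Lemma star_solP s : \det (star_mx s) != 0 ->
  star_mx s *m star_sol s = star_rhs s.
Proof.
by move=> d0; rewrite -scalemxAr mulmxA mul_mx_adj mul_scalar_mx scalerA mulVf // scale1r.
Qed.

Lemma star_mx_inj s (z : 'cV[F]_n) : \det (star_mx s) != 0 ->
  star_mx s *m z = star_rhs s -> z = star_sol s.
Proof.
by move=> d0 zE; rewrite /star_sol -zE mulmxA mul_adj_mx mul_scalar_mx scalerA mulVf // scale1r.
Qed.

Lemma star_mx_ker s (z : 'cV[F]_n) : \det (star_mx s) != 0 ->
  star_mx s *m z = 0 -> z = 0.
Proof.
move=> d0 zE; have : \adj (star_mx s) *m (star_mx s *m z) = 0 by rewrite zE mulmx0.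
by rewrite mulmxA mul_adj_mx mul_scalar_mx => /eqP; rewrite scaler_eq0 (negPf d0) => /eqP.
Qed.

Lemma rational_edge_weight i j : rational (fun s => edge_weight s i j).
Proof.
apply: rational_sum => a _.
by apply: rational_ext (rational_poly 'X_a) => s; rewrite mevalXU.
Qed.

Lemma edge_weight_ones i j : edge_weight (ones F #|edges g|) i j = (g i j)%:R.
Proof.
case gij : (g i j); last by rewrite edge_weight_eq0 ?gij.
by have [a /edge_weight_eq ->] := edge_index gij; rewrite mxE.
Qed.

Lemma star_ones_row (z : 'cV[F]_n) i : i \in Q ->
  \sum_(j in Q) edge_weight (ones F #|edges g|) i j * z j 0 = \sum_(j in Q) z j 0 - z i 0.
Proof.
move=> iQ; rewrite (bigD1 i) //= edge_weight_ones girr mul0r add0r.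
rewrite [in RHS](bigD1 i) //= addrAC subrr add0r; apply: eq_bigr => j /andP [jQ ji].
by rewrite edge_weight_ones Qcl ?mul1r // eq_sym.
Qed.

Hypothesis Q0 : Q != set0.

Let cardQ : (#|Q|%:R : F) != 0.
Proof. by rewrite pnatr_eq0 cards_eq0. Qed.

(** At this point S is J - I on the clique [Q], with J the all-ones matrix. A kernel vector has sum
    0 over [Q], so its entries there equal - z_v and |Q| z_v = 0; the identity rows outside [Q] kill
    the other entries. *)
Lemma star_det_ones : \det (star_mx (ones F #|edges g|)) != 0.
Proof.
rewrite -det_tr; apply/det0P => -[z0 z0n0 zA].
pose z := z0^T; have {zA} Az : star_mx (ones F #|edges g|) *m z = 0.
  by apply: trmx_inj; rewrite trmx_mul trmxK zA trmx0.
have E i : (star_mx (ones F #|edges g|) *m z) i 0 = 0 by rewrite Az mxE.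
have sum0 : \sum_(j in Q) z j 0 = 0 by have := E v; rewrite star_mx_mulE eqxx.
have zQ i : i \in Q -> z i 0 = - z v 0.
  move=> iQ; have := E i; rewrite star_mx_mulE iQ (negPf (Uv (QU iQ))).
  rewrite star_ones_row // sum0 sub0r => /eqP; rewrite subr_eq0 => /eqP <-.
  by rewrite opprK.
have zv : z v 0 = 0.
  move: sum0; rewrite (eq_bigr _ zQ) sumr_const -mulr_natl => /eqP.
  by rewrite mulf_eq0 (negPf cardQ) oppr_eq0 => /eqP.
case/eqP: z0n0; apply: trmx_inj; rewrite trmx0 -/z; apply/colP=> i; rewrite [RHS]mxE.
have [->//|iv] := eqVneq i v.
case iQ : (i \in Q); first by rewrite zQ // zv oppr0.
by have := E i; rewrite star_mx_mulE iQ (negPf iv).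
Qed.

(** The entry of [star_sol] at [v] is cut off: it is the constant c, not a share of the
    conductance. *)
Definition star_part s i : F := if i \in Q then star_sol s i 0 else 0.

Definition star_inv_deg s : F :=
  (\sum_(j in Q) star_part s j * edge_weight s v j - star_sol s v 0) / 2.

(** Here z_q = 1 / |Q|, c = - 1 / |Q| and z.b = 1, so the value is (1 + 1 / |Q|) / 2; its vanishing
    would mean |Q| + 1 = 0. *)
Lemma star_inv_deg_ones : star_inv_deg (ones F #|edges g|) != 0.
Proof.
rewrite /star_inv_deg; set z := star_sol _; have := star_solP star_det_ones; rewrite -/z => zE.
have E i : (star_mx (ones F #|edges g|) *m z) i 0 = star_rhs (ones F #|edges g|) i 0 by rewrite zE.
have sum1 : \sum_(j in Q) z j 0 = 1 by have := E v; rewrite star_mx_mulE [RHS]mxE !eqxx.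
have zQ i : i \in Q -> z i 0 = - z v 0.
  move=> iQ; have := E i; rewrite star_mx_mulE [RHS]mxE iQ (negPf (Uv (QU iQ))).
  rewrite star_ones_row // sum1 edge_weight_ones.
  move: (iQ); rewrite inE => /andP [_ ->] /= e.
  by transitivity (1 - (1 - z i 0 - z v 0) - z v 0); [ring|rewrite e; ring].
have -> : \sum_(j in Q) star_part (ones F #|edges g|) j * edge_weight (ones F #|edges g|) v j = 1.
  transitivity (\sum_(j in Q) z j 0); last exact: sum1.
  apply: eq_bigr => j jQ; rewrite /star_part jQ edge_weight_ones.
  by move: jQ; rewrite inE => /andP [_ ->]; rewrite mulr1.
apply/eqP=> /eqP; rewrite mulf_eq0 invr_eq0 pnatr_eq0 orbF subr_eq0 => /eqP zv.
move: sum1; rewrite (eq_bigr _ zQ) sumr_const -zv -mulr_natl mulrN1 => /eqP.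
by rewrite -subr_eq0 -opprD oppr_eq0 natr1 pnatr_eq0.
Qed.

Lemma rational_star_mx i j : rational (fun s => star_mx s i j).
Proof.
apply: (@rational_ext _ _ (fun s => if i == v then (j \in Q)%:R
  else if i \in Q then if j \in Q then edge_weight s i j else - (j == v)%:R
  else (i == j)%:R)); first by move=> s; rewrite mxE.
case: (i == v); first exact: rational_cst.
case: (i \in Q); last exact: rational_cst.
by case: (j \in Q); [apply: rational_edge_weight|apply: rational_cst].
Qed.

Lemma rational_star_sol i : rational (fun s => star_sol s i 0).
Proof.
apply: rational_solve star_det_ones i => [|i]; first exact: rational_star_mx.
apply: (@rational_ext _ _ (fun s => if i == v then 1
  else if i \in Q then edge_weight s v i else 0)); first by move=> s; rewrite mxE.
case: (i == v); first exact: rational_cst.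
by case: (i \in Q); [apply: rational_edge_weight|apply: rational_cst].
Qed.

Lemma rational_star_part i : rational (fun s => star_part s i).
Proof.
rewrite /star_part; case: (i \in Q); [exact: rational_star_sol|exact: rational_cst].
Qed.

Lemma rational_star_inv_deg : rational (fun s => star_inv_deg s).
Proof.
rewrite /star_inv_deg; apply: rationalM; last exact: rational_cst.
apply: rationalD; last first.
  by apply: rationalN; apply: rational_star_sol.
apply: rational_sum => j _; apply: rationalM; first exact: rational_star_part.
exact: rational_edge_weight.
Qed.

(** Inverse of the star-mesh transformation: the mesh d z_i z_j, equivalent to the star, is
    subtracted from [w']. *)
Definition add_star (w' : 'I_n -> 'I_n -> F) (z : 'I_n -> F) d i j : F :=
  if i == j then 0 else if i == v then d * z j else if j == v then d * z i
  else w' i j - d * z i * z j.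

(** Up to sign, the off-diagonal part of the Schur complement of the Laplacian at its diagonal entry
    [d] in position [v]. *)
Definition star_mesh (w : 'I_n -> 'I_n -> F) d i j : F :=
  if [&& i \in U, j \in U & i != j] then w i j + w v i * w v j / d else 0.

Lemma weight_on_star w : weight_on (v |: U) w -> forall i, i \notin Q -> w v i = 0.
Proof.
move=> [_ w0] i iQ; apply: w0; apply: contra iQ; rewrite !inE.
by move=> /and3P [_ /predU1P [->|->] gvi]; rewrite ?girr // in gvi *.
Qed.

Lemma weight_on_star_mesh w d :
  weight_on (v |: U) w -> weight_on U (star_mesh w d).
Proof.
move=> ww; have [wC w0] := ww; split=> [i j|i j nij]; rewrite /star_mesh.
  by rewrite andbCA eq_sym wC [_ * w v j]mulrC.
case: ifP => // /and3P [iU jU ij]; rewrite iU jU /= in nij.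
rewrite w0 ?(negPf nij) ?andbF // add0r.
have [iQ|iQ] := boolP (i \in Q); last by rewrite (weight_on_star ww iQ) !mul0r.
have [jQ|jQ] := boolP (j \in Q); last by rewrite (weight_on_star ww jQ) mulr0 mul0r.
by rewrite Qcl in nij.
Qed.

(** Gaussian elimination: adding w_vi / d times row v of the resistance equation to row i removes
    R_vj, so the same [R] serves the reduced network. *)
Lemma resistance_eq_star_mesh w R tau d :
  weight_on (v |: U) w -> resistance_eq (v |: U) w R tau ->
  d = \sum_l w v l -> d != 0 ->
  resistance_eq U (star_mesh w d) R (fun i => tau i + w v i * tau v / d).
Proof.
move=> ww wR dE d0 i j iU jU; have [wC _] := ww.
have wvv : w v v = 0 by apply: weight_on_star.
have {}dE : d = \sum_(l | l != v) w v l by rewrite dE (bigD1 v) //= wvv add0r.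
have vj : (v == j) = false by apply/negbTE; rewrite eq_sym Uv.
have := wR v j (setU11 v U) (setU1r v jU); rewrite vj (bigD1 v) //= wvv mul0r add0r.
have := wR i j (setU1r v iU) (setU1r v jU); rewrite (bigD1 v) //= wC => ei ev.
rewrite (bigD1 v) //= {1}/star_mesh (negPf vU) andbF mul0r add0r.
transitivity (\sum_(l | l != v) (w i l * (R i j - R l j) +
    w v i / d * (w v l * (R i j - R l j)))).
  apply: eq_bigr => l lv; rewrite /star_mesh iU /=.
  have [<-|il] /= := eqVneq i l; first by rewrite subrr !mulr0 addr0.
  rewrite andbT; case lU : (l \in U); first by field.
  have lQ : l \notin Q by apply: contraFN lU; apply: QU.
  rewrite (weight_on_star ww lQ) (proj2 ww) ?mul0r ?mulr0 ?addr0 //.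
  by rewrite !inE lU (negPf lv) /= andbF.
rewrite big_split /= -mulr_sumr.
have -> : \sum_(l | l != v) w v l * (R i j - R l j) =
    \sum_(l | l != v) w v l * (R v j - R l j) + d * (R i j - R v j).
  by rewrite dE mulr_suml -big_split /=; apply: eq_bigr => l _; ring.
rewrite ev; apply: (addrI (w v i * (R i j - R v j))); rewrite addrA ei.
by field.
Qed.

Lemma weight_on_add_star w' z d :
  weight_on U w' -> (forall i, i \notin Q -> z i = 0) ->
  weight_on (v |: U) (add_star w' z d).
Proof.
move=> [wC w0] z0; split=> [i j|i j nij]; rewrite /add_star.
  rewrite eq_sym; case: eqP => // /eqP ij; case: eqP => [iv|_].
    by case: eqP => // jv; rewrite iv jv eqxx in ij.
  by case: eqP => // _; rewrite wC mulrAC.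
case: eqP => // /eqP ij; case: eqP => [iv|/eqP iv].
  rewrite z0 ?mulr0 //; apply: contra nij; rewrite iv !inE eqxx /=.
  by move=> /andP [-> ->]; rewrite orbT.
case: eqP => [jv|/eqP jv].
  rewrite z0 ?mulr0 //; apply: contra nij; rewrite jv !inE eqxx /=.
  by move=> /andP [-> gvi]; rewrite orbT gsym.
rewrite w0; last by apply: contra nij => /and3P [iU jU gij]; rewrite !inE iU jU gij !orbT.
have [iQ|iQ] := boolP (i \in Q); last by rewrite (z0 i iQ) mulr0 mul0r subr0.
have [jQ|jQ] := boolP (j \in Q); last by rewrite (z0 j jQ) mulr0 subr0.
by case/negP: nij; rewrite !inE (QU iQ) (QU jQ) !orbT Qcl.
Qed.

(** The values at [v] are those that row v of the resistance equation forces. *)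
Definition add_star_resistance (R' : 'I_n -> 'I_n -> F) (z : 'I_n -> F) c i j : F :=
  if i == j then 0 else if i == v then \sum_l z l * R' l j - c
  else if j == v then \sum_l z l * R' l i - c else R' i j.

Lemma resistance_add_star w' R' z c d :
  weight_on U w' -> resistance U w' R' ->
  (forall i, i \notin Q -> z i = 0) -> \sum_l z l = 1 -> d != 0 ->
  d^-1 = (\sum_j z j * (\sum_l z l * R' l j - c) - c) / 2 ->
  resistance (v |: U) (add_star w' z d) (add_star_resistance R' z c).
Proof.
move=> ww' [RC R0 [tau' wR']] z0 z1 d0 dE.
set R := add_star_resistance R' z c; set w := add_star w' z d.
have ww : weight_on (v |: U) w by apply: weight_on_add_star.
have wvv : w v v = 0 by rewrite /w /add_star eqxx.
have zv : z v = 0 by apply: z0.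
have RvE j : j != v -> R v j = \sum_l z l * R' l j - c.
  by rewrite /R /add_star_resistance eq_sym => /negPf ->; rewrite eqxx.
have RC' i j : R i j = R j i.
  rewrite /R /add_star_resistance eq_sym; case: eqP => // /eqP ij.
  case: eqP => [iv|_]; case: eqP => [jv|_] //; by rewrite iv jv eqxx in ij.
have RE i j : i != v -> j != v -> R i j = R' i j.
  move=> /negPf iv /negPf jv; rewrite /R /add_star_resistance iv jv.
  by case: eqP => // ->; rewrite R0.
have Rvv : R v v = 0 by rewrite /R /add_star_resistance eqxx.
have wvE l : w v l = d * z l.
  by rewrite /w /add_star eqxx; case: eqP => // <-; rewrite zv mulr0.
have [wC _] := ww.
have zsum (f : 'I_n -> F) : \sum_l z l * f l = \sum_(l | l != v) z l * f l.
  by rewrite (bigD1 v) //= zv mul0r add0r.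
have z1' : \sum_(l | l != v) z l = 1 by rewrite -z1 [in RHS](bigD1 v) //= zv add0r.
have dE' : \sum_j z j * R v j = 2 / d + c.
  rewrite dE; apply: (addIr (- c)).
  rewrite (_ : \sum_j z j * R v j = \sum_j z j * (\sum_l z l * R' l j - c)); first by field.
  by rewrite !zsum; apply: eq_bigr => j jv; rewrite RvE.
have w'v i : w' i v = 0 by apply: (proj2 ww'); rewrite (negPf vU) andbF.
(* The row of [w] differs from that of [w'] by d z_i times the z-average of [f] minus [f v]. *)
have rowE i (f : 'I_n -> F) : i \in U -> \sum_l w i l * (f i - f l) =
    d * z i * (f i - f v) + \sum_l w' i l * (f i - f l) - d * z i * (f i - \sum_l z l * f l).
  move=> iU; have iv := Uv iU; rewrite (bigD1 v) //= wC wvE -!addrA; congr (_ + _).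
  rewrite [in RHS](bigD1 v) //= w'v mul0r add0r zsum.
  have -> : f i - \sum_(l | l != v) z l * f l = \sum_(l | l != v) z l * (f i - f l).
    by under [RHS]eq_bigr => l _ do rewrite mulrBr; rewrite sumrB -mulr_suml z1' mul1r.
  rewrite mulr_sumr -sumrB.
  apply: eq_bigr => l lv; rewrite /w /add_star (negPf iv) (negPf lv).
  by have [->|_] := eqVneq i l; [rewrite !subrr; ring|ring].
split=> // [i|]; first by rewrite /R /add_star_resistance eqxx.
(* Obtained by solving tau'_i = tau_i + z_i tau_v, the relation produced by elimination, with c = -
   2 tau_v / d. *)
exists (fun i => if i == v then - (d * c) / 2 else tau' i + d * c * z i / 2).
move=> i j; rewrite !in_setU1 => /predU1P [->|iU] /predU1P [->|jU]; rewrite ?eqxx /=.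
- under eq_bigr => l _ do rewrite wvE Rvv sub0r RC' mulrN -mulrA.
  by rewrite sumrN -mulr_sumr dE'; field.
- rewrite (_ : v == j = false) /=; last by rewrite eq_sym; apply/negbTE/Uv.
  under eq_bigr => l _ do rewrite wvE -mulrA.
  rewrite -mulr_sumr.
  rewrite (_ : \sum_l z l * (R v j - R l j) = - c); first by field.
  under eq_bigr => l _ do rewrite mulrBr.
  rewrite sumrB -mulr_suml z1 mul1r RvE ?Uv //.
  rewrite (_ : \sum_l z l * R l j = \sum_l z l * R' l j); first by ring.
  by rewrite !zsum; apply: eq_bigr => l lv; rewrite RE // Uv.
- rewrite (negPf (Uv iU)) /= (rowE i (fun l => R l v)) // Rvv.
  have -> : \sum_l z l * R l v = 2 / d + c by rewrite -dE'; apply: eq_bigr => l _; rewrite RC'.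
  suff -> : \sum_l w' i l * (R i v - R l v) = 2 * (tau' i - z i) by field.
  transitivity (\sum_q z q * \sum_l w' i l * (R' i q - R' l q)).
    transitivity (\sum_l \sum_q z q * (w' i l * (R' i q - R' l q))); last first.
      by rewrite exchange_big; apply: eq_bigr => q _; rewrite mulr_sumr.
    apply: eq_bigr => l _; have [->|lv] := eqVneq l v.
      by rewrite w'v mul0r big1 // => q _; rewrite mul0r mulr0.
    have iv := Uv iU; rewrite [R i v]RC' [R l v]RC' !RvE //.
    rewrite (_ : forall x y : F, x - c - (y - c) = x - y); last by move=> x y; ring.
    rewrite -sumrB mulr_sumr; apply: eq_bigr => q _; rewrite [R' i q]RC [R' l q]RC; ring.
  transitivity (\sum_q (2 * tau' i * z q - 2 * (z q * (i == q)%:R))).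
    apply: eq_bigr => q _; have [qQ|qQ] := boolP (q \in Q).
      by rewrite (wR' i q iU (QU qQ)); case: (i == q) => /=; ring.
    by rewrite z0 // !mul0r !mulr0 subr0.
  rewrite sumrB -!mulr_sumr z1 (bigD1 i) //= eqxx big1 ?addr0 /=; first by ring.
  by move=> q qi; rewrite eq_sym (negPf qi) mulr0.
- rewrite (negPf (Uv iU)) (rowE i (fun l => R l j)) // RvE ?Uv //.
  rewrite (_ : \sum_l z l * R l j = \sum_l z l * R' l j); last first.
    by rewrite !zsum; apply: eq_bigr => l lv; rewrite RE // Uv.
  rewrite (_ : \sum_l w' i l * (R i j - R l j) = 2 * (tau' i - (i == j)%:R)).
    by case: (i == j) => /=; field.
  rewrite -wR' //; apply: eq_bigr => l _; have [->|lv] := eqVneq l v.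
    by rewrite w'v !mul0r.
  by rewrite !RE // Uv.
Qed.

Lemma star_part_notin s i : i \notin Q -> star_part s i = 0.
Proof. by rewrite /star_part => /negPf ->. Qed.

(** The equations of the star system indexed by [Q] say that the new resistances from [v] agree with
    [s]. *)
Lemma has_resistances_add_star s w' :
  \det (star_mx s) != 0 -> star_inv_deg s != 0 -> has_resistances U s w' ->
  has_resistances (v |: U) s (add_star w' (star_part s) (star_inv_deg s)^-1).
Proof.
move=> det0 deg0 [ww' [R' rR' R's]]; have [RC R0 _] := rR'.
have E i : (star_mx s *m star_sol s) i 0 = star_rhs s i 0 by rewrite star_solP.
have part_sum (f : 'I_n -> F) :
    \sum_l star_part s l * f l = \sum_(l in Q) f l * star_sol s l 0.
  rewrite [RHS]big_mkcond; apply: eq_bigr => l _; rewrite /star_part; case: ifP => _.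
    by rewrite mulrC.
  by rewrite mul0r.
have bE j : j \in Q ->
    \sum_l star_part s l * R' l j - star_sol s v 0 = edge_weight s v j.
  move=> jQ; have := E j; rewrite star_mx_mulE [RHS]mxE jQ (negPf (Uv (QU jQ))) => <-.
  rewrite part_sum; congr (_ - _); apply: eq_bigr => l lQ; congr (_ * _).
  have [->|lj] := eqVneq l j; first by rewrite R0 edge_weight_eq0 ?girr.
  by rewrite R's ?QU // ?Qcl // edge_weightC.
split; first by apply: weight_on_add_star => // i; apply: star_part_notin.
exists (add_star_resistance R' (star_part s) (star_sol s v 0)).
  apply: resistance_add_star => //; first by move=> i; apply: star_part_notin.
  - have := E v; rewrite star_mx_mulE [RHS]mxE !eqxx => <-.
    by rewrite [RHS]big_mkcond.
  - by rewrite invr_eq0.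
  rewrite invrK /star_inv_deg; congr ((_ - _) / _); rewrite [LHS]big_mkcond.
  apply: eq_bigr => j _; case: ifP => jQ; first by rewrite bE.
  by rewrite star_part_notin ?jQ // mul0r.
have RvE j : j \in U -> g v j -> edge_weight s v j =
    add_star_resistance R' (star_part s) (star_sol s v 0) v j.
  move=> jU gvj; rewrite /add_star_resistance eqxx.
  by rewrite eq_sym (negPf (Uv jU)) bE // inE jU.
move=> i j; rewrite !in_setU1 => /predU1P [->|iU] /predU1P [->|jU].
- by rewrite girr.
- by move=> gvj; rewrite RvE.
- rewrite gsym => gvi; rewrite edge_weightC RvE //.
  by rewrite /add_star_resistance (negPf (Uv iU)) !eqxx eq_sym (negPf (Uv iU)).
move=> gij; rewrite /add_star_resistance (negPf (Uv iU)) (negPf (Uv jU)).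
by case: eqP => [ij|_]; [rewrite ij girr in gij|apply: R's].
Qed.

(** In any network on [v |: U], the weights at [v], completed by - 2 tau_v in position [v], solve
    the star system with right-hand side multiplied by d; invertibility therefore determines the
    star. *)
Lemma has_resistances_star s w :
  \det (star_mx s) != 0 -> star_inv_deg s != 0 -> has_resistances (v |: U) s w ->
  exists2 w', has_resistances U s w' &
    forall i j, w i j = add_star w' (star_part s) (star_inv_deg s)^-1 i j.
Proof.
move=> det0 deg0 [ww [R [RC R0 [tau wR]] Rs]]; have [wC w0] := ww.
pose d := \sum_l w v l.
have dQ (f : 'I_n -> F) : \sum_(l in Q) f l * w v l = \sum_l w v l * f l.
  rewrite big_mkcond; apply: eq_bigr => l _; case: ifP => lQ; first by rewrite mulrC.
  by rewrite (weight_on_star ww) ?lQ // mul0r.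
have d1 : \sum_(l in Q) w v l = d.
  rewrite -[LHS](eq_bigr _ (fun l _ => mul1r (w v l))) (dQ (fun=> 1)).
  by apply: eq_bigr => l _; rewrite mulr1.
have ReqQ j l : j \in Q -> l \in Q -> edge_weight s j l = R l j.
  move=> jQ lQ; have [->|jl] := eqVneq j l; first by rewrite R0 edge_weight_eq0 ?girr.
  by rewrite RC Rs ?setU1r ?QU // Qcl.
have bE j : j \in Q -> edge_weight s v j = R v j.
  move=> jQ; rewrite Rs ?setU11 ?setU1r ?QU //.
  by move: jQ; rewrite inE => /andP [].
have ev j : j \in Q -> \sum_(l in Q) edge_weight s j l * w v l = d * R v j - 2 * tau v.
  move=> jQ; transitivity (\sum_(l in Q) R l j * w v l).
    by apply: eq_bigr => l lQ; rewrite ReqQ.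
  rewrite (dQ (fun l => R l j)); apply/eqP; rewrite -subr_eq0 opprB addrC addrAC.
  rewrite subr_eq0; apply/eqP.
  have := wR v j (setU11 v U) (setU1r v (QU jQ)); rewrite eq_sym (negPf (Uv (QU jQ))) subr0 => <-.
  rewrite /d mulr_suml -big_split /=; apply: eq_bigr => l _; ring.
have evv : \sum_l w v l * R v l = 2 - 2 * tau v.
  have := wR v v (setU11 v U) (setU11 v U); rewrite eqxx => e.
  transitivity (- (2 * (tau v - 1))); last by ring.
  rewrite -e -sumrN; apply: eq_bigr => l _; rewrite R0 [R l v]RC; ring.
(* The scale [k] is 1 while d could still vanish, and then d^-1 to normalise the sum to 1. *)
pose zeta k : 'cV[F]_n := \col_i if i == v then - 2 * tau v * k
  else if i \in Q then w v i * k else 0.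
have zetaQ k l : l \in Q -> zeta k l 0 = w v l * k.
  by move=> lQ; rewrite mxE lQ (negPf (Uv (QU lQ))).
have zetav k : zeta k v 0 = - 2 * tau v * k by rewrite mxE eqxx.
have zetaS k : \sum_(l in Q) zeta k l 0 = d * k.
  by rewrite (eq_bigr _ (zetaQ k)) -mulr_suml d1.
have zetaE k j : j \in Q ->
    \sum_(l in Q) edge_weight s j l * zeta k l 0 - zeta k v 0 = d * k * R v j.
  move=> jQ; rewrite zetav (eq_bigr (fun l => edge_weight s j l * w v l * k)).
    by rewrite -mulr_suml ev //; ring.
  by move=> l lQ; rewrite zetaQ // mulrA.
(* If d = 0 then [zeta 1] is in the kernel of the star matrix, so the star and tau_v vanish and
   [evv] reads 0 = 2. *)
have d0 : d != 0.
  apply/eqP=> d0.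
  have z0 : zeta 1 = 0.
    apply: (star_mx_ker det0); apply/colP=> i; rewrite star_mx_mulE [RHS]mxE.
    case: eqP => [_|/eqP iv]; first by rewrite zetaS d0 mul0r.
    case: ifP => iQ; first by rewrite zetaE // d0 !mul0r.
    by rewrite mxE (negPf iv) iQ.
  have w0' l : w v l = 0.
    have [lQ|lQ] := boolP (l \in Q); last exact: (weight_on_star ww).
    by rewrite -[LHS]mulr1 -zetaQ // z0 mxE.
  have tv : 2 * tau v = 0.
    by apply: oppr_inj; rewrite -mulNr -[LHS]mulr1 -zetav z0 mxE oppr0.
  move: evv; rewrite tv subr0 big1 => [/esym/eqP|l _]; last by rewrite w0' mul0r.
  by rewrite pnatr_eq0.
have solE : zeta d^-1 = star_sol s.
  apply: (star_mx_inj det0); apply/colP=> i; rewrite star_mx_mulE [RHS]mxE.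
  case: eqP => [_|/eqP iv]; first by rewrite zetaS divff.
  case: ifP => iQ; first by rewrite zetaE // divff // mul1r bE.
  by rewrite mxE (negPf iv) iQ.
have partE l : star_part s l = w v l / d.
  rewrite /star_part -solE; case: ifP => lQ; first by rewrite zetaQ.
  by rewrite (weight_on_star ww) ?lQ // mul0r.
have degE : star_inv_deg s = d^-1.
  rewrite /star_inv_deg -solE zetav.
  transitivity ((\sum_l w v l * R v l / d + 2 * tau v / d) / 2); last first.
    by rewrite -mulr_suml evv; field.
  congr (_ / _); rewrite !mulNr opprK; congr (_ + _).
  rewrite [LHS]big_mkcond; apply: eq_bigr => l _; case: ifP => lQ.
    by rewrite partE bE // mulrAC.
  by rewrite (weight_on_star ww) ?lQ // !mul0r.
exists (star_mesh w d).
  split; first exact: weight_on_star_mesh.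
  exists R; last by move=> i j iU jU; apply: Rs; apply: setU1r.
  split=> //; exists (fun i => tau i + w v i * tau v / d).
  exact: resistance_eq_star_mesh.
move=> i j; rewrite /add_star degE invrK !partE.
have [->|ij] := eqVneq i j; first by rewrite w0 // girr !andbF.
have [->|iv] := eqVneq i v; first by field.
have [->|jv] := eqVneq j v; first by rewrite wC; field.
rewrite /star_mesh ij andbT; case: ifP => [_|nU]; first by field.
have nU' : ~~ [&& i \in v |: U, j \in v |: U & g i j].
  by rewrite !inE (negPf iv) (negPf jv) /= andbA nU.
rewrite w0 // sub0r.
have [iU|iU] := boolP (i \in U); last first.
  by rewrite (weight_on_star ww (_ : i \notin Q)) ?mul0r ?mulr0 ?mul0r ?oppr0 //; apply: contra iU; apply: QU.
rewrite iU /= in nU.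
by rewrite (weight_on_star ww (_ : j \notin Q)) ?mul0r ?mulr0 ?oppr0 //; apply: contraFN nU; apply: QU.
Qed.

End Step.

Theorem elimination_resistances U : elimination_ordered g U ->
  exists2 omega : 'rV[F]_#|edges g| -> 'I_n -> 'I_n -> F,
    forall i j, rational (fun s => omega s i j) &
    generic (fun s => unique_network U s (omega s)).
Proof.
elim=> {U} [v|U v _ [omega omr omP] vU Q0 Qcl].
  exists (fun _ _ _ => 0); first by move=> i j; apply: rational_cst.
  apply: genericT => s; split=> [|w [[_ w0] _] i j].
    split; first by split.
    exists (fun _ _ => 0).
      (* On a single vertex the left-hand side is 0, and tau = 1 cancels the diagonal term. *)
      split=> //; exists (fun=> 1) => i j /set1P -> /set1P ->.
      by rewrite big1 => [|l _]; rewrite ?mul0r // eqxx subrr mulr0.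
    by move=> i j /set1P -> /set1P ->; rewrite girr.
  by apply: w0; apply/and3P=> -[/set1P -> /set1P ->]; rewrite girr.
exists (fun s => add_star v (omega s) (star_part U v s) (star_inv_deg U v s)^-1).
  have zr := rational_star_part vU Qcl Q0.
  have dr : rational (fun s => (star_inv_deg U v s)^-1).
    by apply: rationalV; [apply: rational_star_inv_deg|apply: star_inv_deg_ones].
  move=> i j; rewrite /add_star; case: (i == j); first exact: rational_cst.
  case: (i == v); first exact: rationalM.
  case: (j == v); first exact: rationalM.
  by apply: rationalD (omr i j) _; apply: rationalN; do 2?apply: rationalM.
have detr : rational (fun s => \det (star_mx U v s)).
  by apply: rational_det; apply: rational_star_mx.
have g1 := generic_neq0 detr (star_det_ones vU Qcl Q0).
have g2 := generic_neq0 (rational_star_inv_deg vU Qcl Q0) (star_inv_deg_ones vU Qcl Q0).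
apply: generic_sub (genericI (genericI g1 g2) omP) => s [[det0 deg0] [oms omu]].
split; first exact: has_resistances_add_star.
move=> w /(has_resistances_star vU Qcl det0 deg0) [w' w's wE] i j.
by rewrite wE /add_star (omu w' w's).
Qed.

End StarMesh.

(** * Matrix-tree theorem *)

Lemma sum_lift (F : pzRingType) n (k : 'I_n) (f : 'I_n -> F) :
  \sum_i f i = f k + \sum_(i < n.-1) f (lift k i).
Proof. by rewrite (bigD1_ord k). Qed.

(** * Determinants attached to parent maps *)

Section RootedMaps.
Variables (n : nat) (k : 'I_n) (F : fieldType).
Implicit Types phi : {ffun 'I_n.-1 -> 'I_n}.

(* phi sends each vertex other than k to its parent; the existence of a rank
   decreasing along phi says that phi is a tree rooted at k. *)
Definition rooted phi : Prop :=
  exists dep : 'I_n -> nat, forall i, (dep (phi i) < dep (lift k i))%N.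

Definition parent_mx phi : 'M[F]_n.-1 :=
  \matrix_(i, j) ((i == j)%:R - (phi i == lift k j)%:R).

(** A permutation with nonzero product sends each index to itself or to its parent, which has
    smaller rank. Permuting preserves the total rank, so only the identity contributes. *)
Lemma det_parent_mx_rooted phi : rooted phi -> \det (parent_mx phi) = 1.
Proof.
move=> [dep depP]; rewrite /determinant (bigD1 (1%g : 'S_n.-1)) //= [X in _ + X]big1 => [|s s1].
  rewrite addr0 odd_perm1 expr0 mul1r big1 // => i _; rewrite mxE perm1 eqxx.
  rewrite (_ : phi i == _ = false) ?subr0 //; apply/negbTE.
  by apply: contraTneq (depP i) => ->; rewrite ltnn.
suff -> : \prod_i parent_mx phi i (s i) = 0 by rewrite mulr0.
apply/eqP; apply: contraNT s1; rewrite prodf_seq_neq0 => /allP s0.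
have sP i : s i != i -> lift k (s i) = phi i.
  move=> si; have := s0 i (mem_index_enum i); rewrite mxE [i == _]eq_sym (negPf si) sub0r oppr_eq0.
  by case: (phi i =P lift k (s i)) => [->|] //=; rewrite eqxx.
have dle i : (dep (lift k (s i)) <= dep (lift k i))%N.
  by have [->//|/sP ->] := eqVneq (s i) i; rewrite ltnW.
apply/eqP/permP=> i; rewrite perm1; apply/eqP; apply: contraT => si.
have : (\sum_j dep (lift k (s j)) < \sum_j dep (lift k j))%N.
  rewrite (bigD1 i) //= [X in (_ < X)%N](bigD1 i) //= -addSn leq_add //.
    by rewrite sP.
  by apply: leq_sum.
rewrite [X in (_ < X)%N](reindex_inj (@perm_inj _ s)) /=.
by rewrite ltnn.
Qed.

(** The root is made a fixed point so that the map can be iterated. *)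
Definition parent phi v : 'I_n := if unlift k v is Some i then phi i else k.

Lemma parent_lift phi i : parent phi (lift k i) = phi i.
Proof. by rewrite /parent liftK. Qed.

(** A vertex reaches [k] exactly when its parent does, so the indicator of the vertices that never
    reach [k] is a kernel vector. It is nonzero, since otherwise the number of steps to [k] would be
    a rank. *)
Lemma det_parent_mx_unrooted phi : ~ rooted phi -> \det (parent_mx phi) = 0.
Proof.
move=> nr; pose reach v := `[< exists m, iter m (parent phi) v = k >].
have [/forallP allr|] := boolP [forall v, reach v].
  case: nr; have ex v : exists m, iter m (parent phi) v == k.
    by have /asboolP [m /eqP] := allr v; exists m.
  exists (fun v => ex_minn (ex v)) => i.
  case: ex_minnP => m _ minm; case: ex_minnP => -[|m'] /eqP /= itm' _.
    by move: (neq_lift k i); rewrite itm' eqxx.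
  by apply: minm; rewrite -parent_lift -iterSr /= itm'.
rewrite negb_forall => /existsP [v0 nv0].
have rk : reach k by apply/asboolP; exists 0%N.
have [i0 i0E] : exists i, v0 = lift k i.
  by case: (unliftP k v0) => [i ->|v0k]; [exists i|rewrite v0k rk in nv0].
have rphi i : reach (phi i) = reach (lift k i).
  apply/asboolP/asboolP=> -[[|m]].
  - by move=> /= pk; exists 1%N; rewrite /= parent_lift.
  - by move=> it; exists m.+2; rewrite iterSr parent_lift.
  - by move=> /= lk; move: (neq_lift k i); rewrite lk eqxx.
  - by rewrite iterSr parent_lift; exists m.
rewrite -det_tr; apply/eqP/det0P.
exists (\row_i (~~ reach (lift k i))%:R).
  apply/eqP=> /rowP /(_ i0); rewrite !mxE -i0E nv0 => /eqP.
  by rewrite oner_eq0.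
apply/rowP=> i; rewrite !mxE.
under eq_bigr => j _ do rewrite !mxE mulrBr.
rewrite sumrB (bigD1 i) //= eqxx mulr1 big1 ?addr0; last first.
  by move=> j ji; rewrite eq_sym (negPf ji) mulr0.
apply/eqP; rewrite subr_eq0; apply/eqP.
case: (unliftP k (phi i)) => [j pj|pk].
  rewrite (bigD1 j) //= pj eqxx mulr1 -pj rphi big1 ?addr0 // => l lj.
  by rewrite pj (inj_eq lift_inj) eq_sym (negPf lj) mulr0.
rewrite -rphi pk rk big1 // => l _.
by rewrite (negPf (neq_lift k l)) mulr0.
Qed.

(** Multilinearity in the rows: row i combines the vectors e_i - e_u with coefficients w, and
    choosing one [u] per row is choosing a map [phi]. *)
Lemma det_row_sum (w : 'I_n -> 'I_n -> F) :
  \det (\matrix_(i < n.-1, j < n.-1)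
     \sum_u w (lift k i) u * ((i == j)%:R - (u == lift k j)%:R)) =
  \sum_(phi : {ffun 'I_n.-1 -> 'I_n} | `[< rooted phi >]) \prod_i w (lift k i) (phi i).
Proof.
transitivity (\sum_(phi : {ffun 'I_n.-1 -> 'I_n})
    (\prod_i w (lift k i) (phi i)) * \det (parent_mx phi)); last first.
  rewrite [RHS]big_mkcond; apply: eq_bigr => phi _; case: asboolP => r.
    by rewrite det_parent_mx_rooted // mulr1.
  by rewrite det_parent_mx_unrooted // mulr0.
under [RHS]eq_bigr => phi _ do rewrite mulr_sumr.
rewrite exchange_big /=; apply: eq_bigr => s _.
under eq_bigr => i _ do rewrite mxE.
rewrite (bigA_distr_bigA (fun i u => w (lift k i) u *
  ((i == s i)%:R - (u == lift k (s i))%:R))) mulr_sumr.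
apply: eq_bigr => phi _; rewrite big_split /= mulrCA; congr (_ * (_ * _)).
by apply: eq_bigr => i _; rewrite mxE.
Qed.

End RootedMaps.

(** * Spanning trees as rooted parent maps *)

Section MatrixTree.
Variables (n : nat) (g : rel 'I_n) (k : 'I_n).
Hypotheses (gsym : ssrbool.symmetric g) (girr : irreflexive g).
Implicit Types (phi : {ffun 'I_n.-1 -> 'I_n}) (T : {set 'I_#|edges g|}).

Definition tree_map phi : Prop := rooted k phi /\ forall i, g (lift k i) (phi i).

Definition map_tree phi : {set 'I_#|edges g|} :=
  [set a | [exists i, enum_val a == [set lift k i; phi i]]].

Lemma subgraph_sym T : ssrbool.symmetric (subgraph T).
Proof. by move=> i j; rewrite /subgraph eq_sym setUC. Qed.

Lemma subgraphP T u v : g u v ->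
  reflect (exists2 a, a \in T & enum_val a = [set u; v]) (subgraph T u v).
Proof.
move=> guv; apply: (iffP andP) => [[_ /existsP [a /andP [aT /eqP]]]|[a aT ae]]; first by exists a.
split; first by apply: contraTneq guv => ->; rewrite girr.
by apply/existsP; exists a; rewrite aT ae eqxx.
Qed.

Lemma subgraph_adj T u v : subgraph T u v -> g u v.
Proof. by move=> /andP [_ /existsP [a /andP [_ /eqP /(edge_val_adj gsym)]]]. Qed.

Lemma subgraph_map_tree phi u v : subgraph (map_tree phi) u v ->
  (exists2 i, u = lift k i & v = phi i) \/ (exists2 i, v = lift k i & u = phi i).
Proof.
move=> /andP [_ /existsP [a /andP []]]; rewrite inE => /existsP [i /eqP ->].
by move=> /eqP /set2_inj [[<- <-]|[<- <-]]; [left|right]; exists i.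
Qed.

Lemma map_tree_subgraph phi i : tree_map phi -> subgraph (map_tree phi) (lift k i) (phi i).
Proof.
move=> [_ gphi]; apply/subgraphP => //; have [a ae] := edge_index (gphi i).
by exists a => //; rewrite inE; apply/existsP; exists i; rewrite ae.
Qed.

Lemma map_tree_connected phi : tree_map phi -> connected_graph (subgraph (map_tree phi)).
Proof.
move=> tphi; have [[dep depP] _] := tphi.
have csym : connect_sym (subgraph (map_tree phi)).
  by apply: sym_connect_sym; apply: subgraph_sym.
suff ck v : connect (subgraph (map_tree phi)) v k.
  by move=> u v; apply: connect_trans (ck u) _; rewrite csym.
have [m] := ubnP (dep v); elim: m v => // m IH v /ltnSE vm.
case: (unliftP k v) => [i vE|-> //]; rewrite vE in vm *.
apply: connect_trans (connect1 (map_tree_subgraph i tphi)) _.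
by apply: IH; apply: leq_trans vm.
Qed.

(* A vertex of maximal rank on a cycle would have both of its neighbours on the
   cycle equal to its parent. *)
Lemma map_tree_acyclic phi : tree_map phi -> acyclic (subgraph (map_tree phi)).
Proof.
move=> tphi c /andP [cc uc]; have [[dep depP] _] := tphi.
rewrite ltnNge; apply/negP => sc.
have [x0 x0c] : exists x0, x0 \in c by case: (c) sc => // x ? _; exists x; rewrite inE eqxx.
have [v vc vmax] := @arg_maxnP _ x0 (fun x => x \in c) dep x0c.
have vpar u : u \in c -> subgraph (map_tree phi) v u -> u = parent k phi v.
  move=> uc' /subgraph_map_tree [[i -> ->]|[i uE vE]]; first by rewrite parent_lift.
  by have : (dep u <= dep v)%N := vmax u uc'; rewrite uE vE leqNgt depP.
have nE := vpar _ (_ : next c v \in c) (next_cycle cc vc).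
have pE := vpar _ (_ : prev c v \in c) (_ : subgraph _ v (prev c v)).
have {nE pE} np : next c v = prev c v.
  by rewrite nE ?mem_next // pE ?mem_prev // subgraph_sym; apply: prev_cycle.
have nn : next c (next c v) = v by rewrite np next_prev.
have [i c' ce] := rot_to vc.
have uc' : uniq (v :: c') by rewrite -ce rot_uniq.
have sc' : (3 <= size (v :: c'))%N by rewrite -ce size_rot.
move: nn; rewrite -!(next_rot i uc) ce.
case: c' ce uc' sc' => [|u [|t c']] // _ /= /and3P [vu ut _] _.
move: vu; rewrite !inE !negb_or => /and3P [vu vt _].
by rewrite !eqxx eq_sym (negPf vu) /= => tv; rewrite tv eqxx in vt.
Qed.

(** Induction on the rank for [phi]. If the edge from i to its [phi]-parent j came in [psi] from j
    having parent i, then by induction j would have parent i under [phi] as well, against the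
    decrease of the rank. *)
Lemma map_tree_inj phi psi : tree_map phi -> tree_map psi ->
  map_tree phi = map_tree psi -> phi = psi.
Proof.
move=> tphi tpsi e; have [[dep depP] _] := tphi.
apply/ffunP=> i; have [m] := ubnP (dep (lift k i)); elim: m i => // m IH i /ltnSE im.
have := map_tree_subgraph i tphi; rewrite e.
case/subgraph_map_tree => [[j /lift_inj <- //]|[j pj lj]].
have := depP i; rewrite pj => dj.
have /IH pjE : (dep (lift k j) < m)%N by apply: leq_trans im.
by have := depP j; rewrite pjE -lj ltnNge (ltnW dj).
Qed.

(** The parent is the next vertex on a shortest path to [k] in [T], with path length as rank. An
    edge of [T] missed by this tree would close a cycle in [T] with the tree path between its
    ends. *)
Lemma spanning_tree_map T : spanning_tree T ->
  exists2 phi, tree_map phi & map_tree phi = T.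
Proof.
move=> [Tc Ta].
have /boolp.choice [p pP] : forall v, exists p, [/\ path (subgraph T) v p,
    last v p = k, uniq (v :: p) &
    forall q, path (subgraph T) v q -> last v q = k -> size p <= size q]%N.
  by move=> v; apply: shortest_path.
pose phi : {ffun 'I_n.-1 -> 'I_n} := [ffun i => head k (p (lift k i))].
have phiP i : subgraph T (lift k i) (phi i) /\ (size (p (phi i)) < size (p (lift k i)))%N.
  rewrite ffunE; have [] := pP (lift k i).
  case: (p (lift k i)) => [_ /= lk|u q /= /andP [eu pq] lq _ _].
    by move: (neq_lift k i); rewrite lk eqxx.
  by split=> //; have [_ _ _] := pP u; apply.
have tphi : tree_map phi.
  split=> [|i]; last by have [/subgraph_adj] := phiP i.
  by exists (fun v => size (p v)) => i; have [] := phiP i.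
exists phi => //; have sub : subrel (subgraph (map_tree phi)) (subgraph T).
  move=> u v /subgraph_map_tree [[i -> ->]|[i -> ->]]; last rewrite subgraph_sym.
    by have [] := phiP i.
  by have [] := phiP i.
apply/setP=> a; apply/idP/idP.
  rewrite inE => /existsP [i /eqP ae]; have [e _] := phiP i.
  have /(subgraphP _ (subgraph_adj e)) [b bT be] := e.
  by rewrite (_ : a = b) //; apply: enum_val_inj; rewrite ae.
move=> aT; have [u [v [guv ae]]] := edge_valP a.
apply: contraT => anT; exfalso.
have euv : subgraph T u v by apply/subgraphP => //; exists a.
have /shortest_path [q [eq lq uq _]] := map_tree_connected tphi u v.
have : ucycle (subgraph T) (u :: q).
  rewrite /ucycle uq andbT /path.cycle rcons_path (sub_path sub eq) lq.
  by rewrite subgraph_sym.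
move=> /Ta; case: q eq lq {uq} => [_ /= uv|t [|? ?] //=].
  by rewrite -uv girr in guv.
rewrite andbT => e tv _; case/negP: anT; move: e; rewrite tv => e.
have /(subgraphP _ guv) [b bT be] := e.
by rewrite (_ : a = b) //; apply: enum_val_inj; rewrite ae.
Qed.

Variable F : fieldType.
Implicit Types x : 'rV[F]_#|edges g|.

Lemma reduced_laplacianE x i j : reduced_laplacian x k i j =
  \sum_u edge_weight x (lift k i) u * ((i == j)%:R - (u == lift k j)%:R).
Proof.
rewrite !mxE (inj_eq lift_inj).
under [RHS]eq_bigr => u _ do rewrite mulrBr.
rewrite sumrB [X in _ - X](bigD1 (lift k j)) //= eqxx mulr1 [X in _ - (_ + X)]big1 ?addr0; last first.
  by move=> u /negPf ->; rewrite mulr0.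
case: eqP => [->|_]; last first.
  by rewrite big1 ?sub0r // => u _; rewrite mulr0.
rewrite edge_weight_eq0 ?girr // subr0 big_mkcond; apply: eq_bigr => u _; rewrite mulr1.
by case: ifP => // gu; rewrite edge_weight_eq0 ?gu.
Qed.

Lemma map_tree_prod x phi : tree_map phi ->
  \prod_(a in map_tree phi) x 0 a = \prod_i edge_weight x (lift k i) (phi i).
Proof.
move=> tphi; have [[dep depP] gphi] := tphi.
have /boolp.choice [f fP] : forall i, exists a : 'I_#|edges g|, enum_val a = [set lift k i; phi i].
  by move=> i; apply: edge_index.
have finj : injective f.
  move=> i j fij; have := fP i; rewrite fij fP => /set2_inj [[/lift_inj //]|[ij ji]].
  by have := depP i; have := depP j; rewrite ji ij => h /(ltn_trans h); rewrite ltnn.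
have -> : map_tree phi = [set f i | i in setT].
  apply/setP=> a; rewrite inE; apply/existsP/imsetP=> [[i /eqP ae]|[i _ ->]].
    by exists i => //; apply: enum_val_inj; rewrite ae fP.
  by exists i; rewrite fP.
rewrite big_imset /=; last by move=> i j _ _; apply: finj.
apply: eq_big => [i|i _]; first by rewrite inE.
by rewrite (edge_weight_eq _ (fP i)).
Qed.

Theorem matrix_tree x : (tree_poly g F).@[x 0] = \det (reduced_laplacian x k).
Proof.
have -> : reduced_laplacian x k = \matrix_(i, j)
    \sum_u edge_weight x (lift k i) u * ((i == j)%:R - (u == lift k j)%:R).
  by apply/matrixP=> i j; rewrite reduced_laplacianE mxE.
rewrite det_row_sum /tree_poly rmorph_sum /=.
transitivity (\sum_(phi in [set phi | `[< tree_map phi >]])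
    \prod_i edge_weight x (lift k i) (phi i)); last first.
  rewrite [LHS]big_mkcond [RHS]big_mkcond; apply: eq_bigr => phi _; rewrite inE.
  case: asboolP => [[r gphi]|nt]; case: asboolP => // r'.
  (* A rooted map using a non-edge contributes 0, as [edge_weight] vanishes there. *)
  have [i gi] : exists i, ~~ g (lift k i) (phi i).
    by apply: contrapT => ng; apply: nt; split=> // i; apply: contrapT => gi;
      apply: ng; exists i; apply/negP.
  by rewrite (bigD1 i) //= edge_weight_eq0 ?mul0r.
transitivity (\sum_(T in [set map_tree phi | phi in [set phi | `[< tree_map phi >]]])
    \prod_(a in T) x 0 a); last first.
  rewrite big_imset /=; last first.
    by move=> phi psi; rewrite !inE => /asboolP tphi /asboolP tpsi; apply: map_tree_inj.
  by apply: eq_bigr => phi; rewrite inE => /asboolP /map_tree_prod.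
apply: eq_big => [T|T _]; last first.
  by rewrite rmorph_prod; apply: eq_bigr => a _; rewrite /= mevalXU.
apply/asboolP/imsetP => [/spanning_tree_map [phi tphi <-]|[phi]].
  by exists phi => //; rewrite inE; apply/asboolP.
rewrite inE => /asboolP tphi ->.
by split; [apply: map_tree_connected|apply: map_tree_acyclic].
Qed.

End MatrixTree.

(** * Gradient and effective resistances *)

Section Jacobi.
Variables (R : comNzRingType) (N : nat).

Lemma mderiv_prod m (f : 'I_m -> {mpoly R[N]}) a :
  (\prod_j f j)^`M(a) = \sum_i \prod_j if j == i then (f j)^`M(a) else f j.
Proof.
elim: m f => [|m IH] f; first by rewrite !big_ord0 -[1]mpolyC1 mderivC.
rewrite big_ord_recr /= mderivM IH big_ord_recr /= mulr_suml; congr (_ + _).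
  apply: eq_bigr => i _; rewrite big_ord_recr /= -val_eqE /= gtn_eqF //=.
rewrite big_ord_recr /= eqxx; congr (_ * _); apply: eq_bigr => j _.
by rewrite -val_eqE /= ltn_eqF.
Qed.

(** Jacobi's formula: differentiate one row at a time, then expand along that row. *)
Lemma mderiv_det m (M : 'M[{mpoly R[N]}]_m) a :
  (\det M)^`M(a) = \tr (map_mx (mderiv a) M *m \adj M).
Proof.
transitivity (\sum_i \det (\matrix_(r, c) if r == i then (M r c)^`M(a) else M r c)).
  rewrite /determinant raddf_sum exchange_big /=; apply: eq_bigr => s _.
  transitivity ((-1) ^+ s * (\prod_i M i (s i))^`M(a)).
    by rewrite !mulr_sign; case: ifP => _ //; rewrite mderivN.
  rewrite mderiv_prod mulr_sumr; apply: eq_bigr => i _; congr (_ * _).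
  by apply: eq_bigr => j _; rewrite mxE.
apply: eq_bigr => i _; rewrite (expand_det_row _ i) !mxE; apply: eq_bigr => j _.
rewrite !mxE eqxx; congr (_ * (_ * \det _)); apply/matrixP=> r c; rewrite !mxE.
by rewrite eq_sym (negPf (neq_lift _ _)).
Qed.

End Jacobi.

Section DetPoly.
Variables (F : fieldType) (m N : nat) (K : N.-tuple 'M[F]_m).
Implicit Type x : 'rV[F]_N.

Lemma det_poly_mx_eval x :
  map_mx (meval (x 0)) (\sum_i 'X_i *: map_mx (@mpolyC N F) (tnth K i)) =
  \sum_i x 0 i *: tnth K i.
Proof.
apply/matrixP=> r c; rewrite !mxE !summxE rmorph_sum; apply: eq_bigr => i _.
by rewrite !mxE rmorphM /= mevalXU mevalC.
Qed.

Lemma det_poly_eval x : (det_poly K).@[x 0] = \det (\sum_i x 0 i *: tnth K i).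
Proof. by rewrite -det_poly_mx_eval det_map_mx. Qed.

Lemma det_poly_deriv x a : ((det_poly K)^`M(a)).@[x 0] =
  \tr (tnth K a *m \adj (\sum_i x 0 i *: tnth K i)).
Proof.
rewrite mderiv_det /mxtrace rmorph_sum /= -det_poly_mx_eval; apply: eq_bigr => r _.
rewrite -map_mx_adj !mxE rmorph_sum; apply: eq_bigr => c _; rewrite !mxE rmorphM.
congr (_ * _); rewrite summxE (raddf_sum (mderiv a)) (raddf_sum (meval (x 0))) (bigD1 a) //= !mxE.
have dX b : (('X_b : {mpoly F[N]}) * (tnth K b r c)%:MP)^`M(a) = (b == a)%:R * (tnth K b r c)%:MP.
  rewrite mderivM mderivC mulr0 addr0 mderivX mnm1E; case: eqP => [->|_].
    rewrite (_ : U_(a) - U_(a) = 0)%MM ?scale1r ?mpolyX0 //.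
    by apply/mnmP=> i; rewrite mnmBE mnm0E subnn.
  by rewrite scale0r.
rewrite dX eqxx mul1r mevalC big1 ?addr0 // => b ba.
by rewrite !mxE dX (negPf ba) mul0r meval0.
Qed.

End DetPoly.

(** * Logarithmic gradient and resistances *)

Section Gradient.
Variables (n : nat) (g : rel 'I_n) (k : 'I_n).
Hypotheses (gsym : ssrbool.symmetric g) (girr : irreflexive g).
Variable F : numFieldType.
Implicit Types x s : 'rV[F]_#|edges g|.
Local Notation P := (tree_poly g F).

Definition edge_mx (a : 'I_#|edges g|) : 'M[F]_n.-1 :=
  reduced_laplacian (delta_mx 0 a) k.

Definition edge_mxs : #|edges g|.-tuple 'M[F]_n.-1 := [tuple edge_mx a | a < #|edges g|].

Lemma edge_weight_delta a i j :
  edge_weight (delta_mx 0 a : 'rV[F]_#|edges g|) i j = (enum_val a == [set i; j])%:R.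
Proof.
rewrite /edge_weight big_mkcond (bigD1 a) //= mxE !eqxx big1 ?addr0; first by case: ifP.
by move=> b ba; rewrite mxE (negPf ba) andbF; case: ifP.
Qed.

Lemma reduced_laplacian_sym x : (reduced_laplacian x k)^T = reduced_laplacian x k.
Proof.
apply/matrixP=> i j; rewrite !mxE eq_sym; case: eqP => [->//|_].
by rewrite edge_weightC.
Qed.

Lemma reduced_laplacian_sum x :
  reduced_laplacian x k = \sum_a x 0 a *: tnth edge_mxs a.
Proof.
apply/matrixP=> i j; rewrite summxE reduced_laplacianE //.
under [RHS]eq_bigr => a _ do rewrite mxE tnth_mktuple /edge_mx reduced_laplacianE // mulr_sumr.
rewrite exchange_big; apply: eq_bigr => u _.
under [RHS]eq_bigr => a _ do rewrite mulrA.
rewrite -mulr_suml; congr (_ * _); rewrite {1}/edge_weight big_mkcond.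
by apply: eq_bigr => a _; rewrite edge_weight_delta; case: ifP; rewrite ?mulr1 ?mulr0.
Qed.

Lemma tree_poly_det_poly : P = det_poly edge_mxs.
Proof.
apply/eqP; rewrite -subr_eq0; apply/eqP/mpoly_eval_eq0 => v.
pose x : 'rV[F]_#|edges g| := \row_a v a.
have vx : v =1 x 0 by move=> a; rewrite mxE.
rewrite (meval_eq _ vx) mevalB (matrix_tree k gsym girr) det_poly_eval.
by rewrite reduced_laplacian_sum subrr.
Qed.

Lemma reduced_laplacian_mul x (f : 'I_n -> F) i : f k = 0 ->
  \sum_j reduced_laplacian x k i j * f (lift k j) =
  \sum_u edge_weight x (lift k i) u * (f (lift k i) - f u).
Proof.
move=> fk; under eq_bigr => j _ do rewrite reduced_laplacianE // mulr_suml.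
rewrite exchange_big; apply: eq_bigr => u _ /=.
under eq_bigr => j _ do rewrite -mulrA.
rewrite -mulr_sumr; congr (_ * _).
under eq_bigr => j _ do rewrite mulrBl.
rewrite sumrB; congr (_ - _).
  rewrite (bigD1 i) //= eqxx mul1r big1 ?addr0 // => j ji.
  by rewrite eq_sym (negPf ji) mul0r.
case: (unliftP k u) => [j ->|->].
  rewrite (bigD1 j) //= eqxx mul1r big1 ?addr0 // => l lj.
  by rewrite (inj_eq lift_inj) eq_sym (negPf lj) mul0r.
by rewrite fk big1 // => l _; rewrite (negPf (neq_lift _ _)) mul0r.
Qed.

(* Gram matrix, with base point k, of the resistances R. *)
Definition gram (R : 'I_n -> 'I_n -> F) u v : F := (R u k + R v k - R u v) / 2.

(** The difference of columns k and j of the resistance equation no longer contains the unknown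
    [tau]. *)
Lemma gram_laplacian x R : resistance setT (edge_weight x) R ->
  reduced_laplacian x k *m (\matrix_(i, j) gram R (lift k i) (lift k j)) = 1%:M.
Proof.
move=> [RC R0 [tau wR]]; apply/matrixP=> i j; rewrite [LHS]mxE [RHS]mxE.
under eq_bigr => l _ do rewrite [X in _ * X]mxE.
rewrite (reduced_laplacian_mul x (f := fun u => gram R u (lift k j))); last first.
  by rewrite /gram R0 add0r RC subrr mul0r.
have e1 := wR (lift k i) k (in_setT _) (in_setT _).
have e2 := wR (lift k i) (lift k j) (in_setT _) (in_setT _).
rewrite eq_sym (negPf (neq_lift _ _)) in e1; rewrite (inj_eq lift_inj) in e2.
transitivity ((\sum_u edge_weight x (lift k i) u * (R (lift k i) k - R u k) -
  \sum_u edge_weight x (lift k i) u * (R (lift k i) (lift k j) - R u (lift k j))) / 2).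
  by rewrite -sumrB mulr_suml; apply: eq_bigr => u _; rewrite /gram; field.
by rewrite e1 e2; case: (i == j) => /=; field.
Qed.

(** [R] comes from the inverse of the reduced Laplacian, padded by zeros at [k]. The rows other than
    k of the resistance equation come from the inverse; row k follows because the columns of the
    Laplacian sum to 0. *)
Lemma resistance_exists x : P.@[x 0] != 0 -> exists R, resistance setT (edge_weight x) R.
Proof.
rewrite (matrix_tree k gsym girr) => det0.
set L := reduced_laplacian x k in det0; have Lu : L \in unitmx by rewrite unitmxE unitfE.
have LC : L^T = L := reduced_laplacian_sym x.
pose S u v : F := match unlift k u, unlift k v with
  Some i, Some j => invmx L i j | _, _ => 0 end.
have Slift i j : S (lift k i) (lift k j) = invmx L i j by rewrite /S !liftK.
have Sk1 v : S k v = 0 by rewrite /S unlift_none.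
have Sk2 v : S v k = 0 by rewrite /S unlift_none; case: unlift.
have SC u v : S u v = S v u.
  rewrite /S; case: (unlift k u) => [i|]; case: (unlift k v) => [j|] //.
  by rewrite -{1}LC -trmx_inv mxE.
pose R u v := S u u + S v v - 2 * S u v.
pose c i := \sum_u edge_weight x i u * (S i i - S u u).
pose D i j := \sum_u edge_weight x i u * (S i j - S u j).
have DE i j : D (lift k i) j = (lift k i == j)%:R.
  rewrite /D -(reduced_laplacian_mul x (f := fun u => S u j)) //.
  case: (unliftP k j) => [l ->|->]; last first.
    rewrite eq_sym (negPf (neq_lift _ _)) big1 // => u _; by rewrite Sk2 mulr0.
  transitivity ((L *m invmx L) i l); last by rewrite mulmxV // mxE (inj_eq lift_inj).
  by rewrite mxE; apply: eq_bigr => u _; rewrite Slift.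
have D0 j : \sum_i D i j = 0.
  have De : \sum_i D i j = - \sum_i D i j.
    rewrite [LHS]exchange_big /= -sumrN; apply: eq_bigr => u _; rewrite -sumrN.
    by apply: eq_bigr => i _; rewrite edge_weightC; ring.
  have : 2 * \sum_i D i j = 0 by rewrite mulr_natl mulr2n {2}De subrr.
  by move/eqP; rewrite mulf_eq0 pnatr_eq0 => /eqP.
have Dk j : D k j = (k == j)%:R - 1.
  have := D0 j; rewrite (sum_lift k) (eq_bigr _ (fun i _ => DE i j)).
  case: (unliftP k j) => [l ->|->].
    rewrite (bigD1 l) //= eqxx big1 ?addr0; last first.
      by move=> i il; rewrite (inj_eq lift_inj) (negPf il).
    by rewrite (negPf (neq_lift _ _)) sub0r => /eqP; rewrite addr_eq0 => /eqP.
  rewrite eqxx subrr big1 ?addr0 // => i _.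
  by rewrite eq_sym (negPf (neq_lift _ _)).
exists R; split=> [u v|u|].
- by rewrite /R SC; ring.
- by rewrite /R; ring.
(* [c i] collects the terms independent of [j]; the extra 1 at [k] absorbs the - 1 of [Dk]. *)
exists (fun i => c i / 2 + (i == k)%:R) => i j _ _.
transitivity (c i - 2 * D i j).
  by rewrite /c /D mulr_sumr -sumrB; apply: eq_bigr => u _; rewrite /R; ring.
case: (unliftP k i) => [l ->|->].
  by rewrite DE [_ == k]eq_sym (negPf (neq_lift _ _)); case: eqP => _ /=; field.
by rewrite Dk eqxx; case: eqP => _ /=; field.
Qed.

(** [edge_mx a] is (e_i - e_j)(e_i - e_j)^T with coordinate [k] deleted; the zeros of [S] at [k]
    make the formula hold also when [k] is an end of the edge. *)
Lemma edge_mx_gram_trace a i j (S : 'I_n -> 'I_n -> F) :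
  enum_val a = [set i; j] -> (forall v, S k v = 0) -> (forall v, S v k = 0) ->
  \tr (edge_mx a *m (\matrix_(r, c) S (lift k r) (lift k c))) =
  S i i - S j i + (S j j - S i j).
Proof.
move=> ae S1 S2; have gij := edge_val_adj gsym ae.
have ij : i != j by apply: contraTneq gij => ->; rewrite girr.
transitivity (\sum_v \sum_u (enum_val a == [set v; u])%:R * (S v v - S u v)).
  rewrite (sum_lift k) big1 ?add0r => [|u _]; last by rewrite !S2 subrr mulr0.
  apply: eq_bigr => r _; rewrite mxE; under eq_bigr => c _ do rewrite [X in _ * X]mxE.
  rewrite (reduced_laplacian_mul _ (f := fun u => S u (lift k r))) //.
  by apply: eq_bigr => u _; rewrite edge_weight_delta.
have eE v u : (enum_val a == [set v; u]) = (v == i) && (u == j) || (v == j) && (u == i).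
  rewrite ae; apply/eqP/orP => [/set2_inj [[-> ->]|[-> ->]]|]; rewrite ?eqxx; auto.
  by move=> [/andP [/eqP -> /eqP ->]|/andP [/eqP -> /eqP ->]] //; rewrite setUC.
have row v : \sum_u (enum_val a == [set v; u])%:R * (S v v - S u v) =
    (v == i)%:R * (S i i - S j i) + (v == j)%:R * (S j j - S i j).
  have [->|vi] := eqVneq v i.
    rewrite (negPf ij) mul0r addr0 mul1r (bigD1 j) //= eE !eqxx mul1r big1 ?addr0 // => u uj.
    by rewrite eE eqxx (negPf uj) (negPf ij) mul0r.
  have [->|vj] := eqVneq v j.
    rewrite mul0r add0r mul1r (bigD1 i) //= eE !eqxx orbT mul1r big1 ?addr0 // => u ui.
    by rewrite eE eqxx (negPf ui) eq_sym (negPf ij) mul0r.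
  by rewrite !mul0r addr0 big1 // => u _; rewrite eE (negPf vi) (negPf vj) mul0r.
rewrite (eq_bigr _ (fun v _ => row v)) big_split /=; congr (_ + _).
  by rewrite -mulr_suml (bigD1 i) //= eqxx big1 ?addr0 ?mul1r // => v /negPf ->.
by rewrite -mulr_suml (bigD1 j) //= eqxx big1 ?addr0 ?mul1r // => v /negPf ->.
Qed.

(** The Gram matrix G inverts the reduced Laplacian, whose adjugate is thus its determinant times G;
    Jacobi's formula leaves the trace of the edge matrix with G. *)
Lemma resistance_gradient x R : resistance setT (edge_weight x) R ->
  P.@[x 0] != 0 /\ forall a i j, enum_val a = [set i; j] ->
    (P^`M(a)).@[x 0] = P.@[x 0] * R i j.
Proof.
move=> rR; have LG := gram_laplacian rR; have [RC R0 _] := rR.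
set G := (\matrix_(i, j) _) in LG.
have PE : P.@[x 0] = \det (reduced_laplacian x k) by apply: matrix_tree.
split.
  rewrite PE; apply/eqP=> d0; have := congr1 determinant LG.
  by rewrite det_mulmx d0 mul0r det1 => /esym/eqP; rewrite oner_eq0.
move=> a i j ae; rewrite PE [in LHS]tree_poly_det_poly det_poly_deriv -reduced_laplacian_sum.
have -> : \adj (reduced_laplacian x k) = \det (reduced_laplacian x k) *: G.
  by rewrite -[LHS]mulmx1 -LG mulmxA mul_adj_mx mul_scalar_mx.
rewrite -scalemxAr mxtraceZ tnth_mktuple; congr (_ * _).
rewrite (edge_mx_gram_trace ae) => [|v|v].
- by rewrite /gram !R0 [R j i]RC; field.
- by rewrite /gram R0 RC; field.
- by rewrite /gram R0; field.
Qed.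

(** The equation grad log P (x) = s, with denominators cleared. *)
Definition gradient_eq x s : Prop :=
  P.@[x 0] != 0 /\ forall a, (P^`M(a)).@[x 0] = P.@[x 0] * s 0 a.

Lemma gradient_eqP x s : gradient_eq x s <-> has_resistances setT s (edge_weight x).
Proof.
split=> [[P0 dP]|[_ [R rR Rs]]].
  have [R rR] := resistance_exists P0; split.
    split=> i j; first exact: edge_weightC.
    by rewrite !inE; apply: edge_weight_eq0.
  exists R => // i j _ _ gij; have [a ae] := edge_index gij.
  rewrite (edge_weight_eq _ ae); have [_ /(_ a i j ae)] := resistance_gradient rR.
  by rewrite dP => /(mulfI P0).
have [P0 dP] := resistance_gradient rR; split=> // a.
have [i [j [gij ae]]] := edge_valP a.
by rewrite (dP a i j ae) Rs ?in_setT // (edge_weight_eq _ ae).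
Qed.

End Gradient.

(** * Inverse of the gradient map *)

Section Homogeneous.
Variables (F : fieldType) (N : nat).
Implicit Types (p : {mpoly F[N]}) (d e : nat).

Lemma dhomog_bigprod (I : Type) (r : seq I) (f : I -> {mpoly F[N]}) (d : I -> nat) :
  (forall i, f i \is (d i).-homog) ->
  \prod_(i <- r) f i \is (\sum_(i <- r) d i)%N.-homog.
Proof.
move=> fd; elim: r => [|i r IH]; first by rewrite !big_nil dhomog1.
by rewrite !big_cons; apply: dhomogM.
Qed.

Lemma dhomog_comp M d e (p : {mpoly F[M]}) (q : M.-tuple {mpoly F[N]}) :
  p \is d.-homog -> (forall i, tnth q i \is e.-homog) -> p \mPo q \is (d * e)%N.-homog.
Proof.
move=> pd qe; rewrite comp_mpolyEX big_seq; apply: rpred_sum => m mp.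
rewrite comp_mpolyX; apply: rpredZ.
have -> : (d * e = \sum_i e * m i)%N.
  by rewrite -big_distrr /= -mdegE (dhomog_mf pd mp) mulnC.
by apply: dhomog_bigprod => i; apply: dhomogMn.
Qed.

Lemma dhomog_mderiv d p i : p \is d.-homog -> p^`M(i) \is d.-1.-homog.
Proof.
move=> pd; apply/dhomogP=> m; rewrite mcoeff_msupp mcoeff_mderiv => pm.
have : (m + U_(i))%MM \in msupp p.
  by rewrite mcoeff_msupp; apply: contraNneq pm => ->; rewrite mul0rn.
move=> mi; have <- : mdeg (m + U_(i))%MM = d := dhomog_mf pd mi.
by rewrite mdegD mdeg1 addn1.
Qed.

Lemma dhomog_eval d p (c : F) (v : 'I_N -> F) : p \is d.-homog ->
  p.@[fun i => c * v i] = c ^+ d * p.@[v].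
Proof.
move=> pd; rewrite !mevalE mulr_sumr big_seq [RHS]big_seq; apply: eq_bigr => m mp.
have <- : mdeg m = d := dhomog_mf pd mp.
rewrite mulrCA mdegE -prodrXr -big_split /=; congr (_ * _).
by apply: eq_bigr => i _; rewrite exprMn.
Qed.

Variable a0 : 'I_N.

(** [d] may exceed the degree of [p], so that several polynomials can be brought to a common
    degree. *)
Definition homogenize d p : {mpoly F[N]} :=
  \sum_(m <- msupp p) p@_m *: ('X_a0 ^+ (d - mdeg m) * 'X_[m]).

Lemma dhomog_homogenize d p : (msize p <= d)%N -> homogenize d p \is d.-homog.
Proof.
move=> pd; rewrite /homogenize big_seq; apply: rpred_sum => m mp; apply: rpredZ.
have md : (mdeg m <= d)%N by apply: leq_trans pd; apply/ltnW/msize_mdeg_lt.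
suff : ('X_a0 ^+ (d - mdeg m) * 'X_[m] : {mpoly F[N]}) \is (1 * (d - mdeg m) + mdeg m)%N.-homog.
  by rewrite mul1n subnK.
apply: dhomogM.
  by apply: dhomogMn; rewrite dhomogX /= mdeg1.
by rewrite dhomogX.
Qed.

Lemma homogenize_eval d p (v : 'I_N -> F) : (msize p <= d)%N -> v a0 != 0 ->
  (homogenize d p).@[v] = v a0 ^+ d * p.@[fun i => v i / v a0].
Proof.
move=> pd v0; rewrite /homogenize rmorph_sum mevalE mulr_sumr big_seq [RHS]big_seq.
apply: eq_bigr => m mp; rewrite /= mevalZ mevalM rmorphXn /= mevalXU mevalX [RHS]mulrCA.
congr (_ * _); have md : (mdeg m <= d)%N by apply: leq_trans pd; apply/ltnW/msize_mdeg_lt.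
rewrite -[X in _ = v a0 ^+ X * _](subnK md) exprD -mulrA; congr (_ * _).
rewrite mdegE -prodrXr -big_split /=; apply: eq_bigr => i _.
by rewrite -exprMn mulrCA divff // mulr1.
Qed.

End Homogeneous.

(** * Birationality and maximum likelihood degree *)

Section GradientInverse.
Variables (n : nat) (g : rel 'I_n) (F : numFieldType).
Hypotheses (n2 : (2 <= n)%N) (gsym : ssrbool.symmetric g) (girr : irreflexive g).
Hypotheses (gcon : connected_graph g) (gch : chordal g).
Implicit Types x s : 'rV[F]_#|edges g|.
Local Notation P := (tree_poly g F).
Local Notation ones := (ones F #|edges g|).

Let k0 : 'I_n := Ordinal (ltnW n2).

Let predn : n.-1 = n.-1.-1.+1.
Proof. by rewrite [RHS]prednK // -subn1 subn_gt0. Qed.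

Lemma rational_gradient_inverse :
  exists2 xi : 'rV[F]_#|edges g| -> 'rV[F]_#|edges g|,
    forall a, rational (fun s => xi s 0 a) &
    generic (fun s => forall x, gradient_eq x s <-> x = xi s).
Proof.
have eo : elimination_ordered g setT.
  apply: chordal_elimination_ordered => //; last exact: cut_connectedT.
  by apply/set0Pn; exists k0.
have [omega omr omP] := elimination_resistances gsym girr F eo.
have /boolp.choice [e eP] : forall a : 'I_#|edges g|, exists ij, enum_val a = [set ij.1; ij.2].
  by move=> a; have [i [j [_ ae]]] := edge_valP a; exists (i, j).
exists (fun s => \row_a omega s (e a).1 (e a).2).
  by move=> a; apply: rational_ext (omr (e a).1 (e a).2) => s; rewrite mxE.
apply: generic_sub omP => s [oms omu] x.
have [[omC om0] _] := oms.
have ewE i j : edge_weight (\row_a omega s (e a).1 (e a).2) i j = omega s i j.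
  case gij : (g i j); last by rewrite edge_weight_eq0 ?gij // om0 // gij !andbF.
  have [a ae] := edge_index gij; rewrite (edge_weight_eq _ ae) mxE.
  by have := eP a; rewrite ae => /set2_inj [[-> ->]|[-> ->]].
rewrite (gradient_eqP k0) //; split=> [/omu xE|->].
  by apply/rowP=> a; rewrite mxE -xE (edge_weight_eq _ (eP a)).
have -> // : edge_weight (\row_a omega s (e a).1 (e a).2) = omega s.
by apply: funext => i; apply: funext => j.
Qed.

(** With a single denominator for all coordinates, the numerators alone define the same projective
    map. *)
Lemma gradient_inverse : exists (h : {mpoly F[#|edges g|]}) (f : 'I_#|edges g| -> {mpoly F[#|edges g|]}),
  h.@[ones 0] != 0 /\ forall s, h.@[s 0] != 0 ->
    forall x, gradient_eq x s <-> x = \row_a ((f a).@[s 0] / h.@[s 0]).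
Proof.
have [xi xir [h0 h01 h0P]] := rational_gradient_inverse.
have /boolp.choice [fh fhP] : forall a, exists fh : {mpoly F[#|edges g|]} * {mpoly F[#|edges g|]},
    fh.2.@[ones 0] != 0 /\ forall s, fh.2.@[s 0] != 0 -> xi s 0 a = fh.1.@[s 0] / fh.2.@[s 0].
  by move=> a; have [f [h fhP]] := xir a; exists (f, h).
exists (h0 * \prod_a (fh a).2), (fun a => (fh a).1 * (h0 * \prod_(b | b != a) (fh b).2)).
split.
  rewrite mevalM mulf_neq0 // rmorph_prod prodf_seq_neq0.
  by apply/allP=> a _; have [] := fhP a.
move=> s; rewrite mevalM mulf_eq0 negb_or rmorph_prod => /andP [h0s].
rewrite prodf_seq_neq0 => /allP hs x; rewrite h0P //.
have -> // : xi s = \row_a (((fh a).1 * (h0 * \prod_(b | b != a) (fh b).2)).@[s 0] /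
  (h0.@[s 0] * \prod_a (fh a).2.@[s 0])).
apply/rowP=> a; pose q := \prod_(b | b != a) (fh b).2.@[s 0].
have qE : (\prod_(b | b != a) (fh b).2).@[s 0] = q by rewrite rmorph_prod.
rewrite mxE !mevalM qE (bigD1 a) //= -/q.
have /= ha := hs a (mem_index_enum a); have [_ ->//] := fhP a.
have q0 : q != 0.
  rewrite /q prodf_seq_neq0; apply/allP=> b _; apply/implyP=> _.
  exact: hs (mem_index_enum b).
by field; rewrite q0 h0s ha.
Qed.

Lemma tree_poly_homog : P \is n.-1.-homog.
Proof.
rewrite (tree_poly_det_poly k0 gsym girr F); apply: rpred_sum => s _.
rewrite mulr_sign.
set M := (\sum_a _); suff pd : \prod_i M i (s i) \is (\sum_(i < n.-1) 1)%N.-homog.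
  by rewrite sum1_card card_ord in pd; case: ifP => _; rewrite ?dhomogN.
apply: dhomog_bigprod => i; rewrite summxE; apply: rpred_sum => a _; rewrite !mxE mulrC mul_mpolyC.
by apply: rpredZ; rewrite dhomogX /= mdeg1.
Qed.

Lemma gradient_eq_neq0 x s : gradient_eq x s -> x != 0.
Proof.
move=> [P0 _]; apply: contraNneq P0 => ->.
rewrite (@meval_eq _ _ _ (fun a => 0 * (0 : 'rV[F]_#|edges g|) 0 a)).
  rewrite (dhomog_eval _ _ tree_poly_homog) expr0n.
  by rewrite predn mul0r.
by move=> a; rewrite mxE mulr0.
Qed.

Lemma gradient_eqZ x s c : c != 0 -> gradient_eq x s -> gradient_eq (c *: x) (c^-1 *: s).
Proof.
move=> c0 [P0 dP].
have sc p : p.@[(c *: x) 0] = p.@[fun a => c * x 0 a] by apply: meval_eq => a; rewrite mxE.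
split=> [|a]; rewrite !sc (dhomog_eval _ _ tree_poly_homog).
  by rewrite mulf_neq0 // expf_neq0.
rewrite (dhomog_eval _ _ (dhomog_mderiv _ tree_poly_homog)) dP mxE.
by rewrite [in RHS]predn exprS; field.
Qed.

Theorem tree_poly_homaloidal : homaloidal P.
Proof.
have Ph := tree_poly_homog; split; first by exists n.-1.
have dPh a := dhomog_mderiv a Ph.
have [h [f [h1 hf]]] := gradient_inverse.
pose x1 : 'rV[F]_#|edges g| := \row_a ((f a).@[ones 0] / h.@[ones 0]).
have x1P : gradient_eq x1 ones by apply/hf.
have [P1 dP1] := x1P.
(* [a1] is both the homogenising variable and the coordinate used to see that the inverse and the
   composites are not identically zero. *)
have [a1 x1a1] : exists a1, x1 0 a1 != 0.
  by apply: contrapT => nx; case/eqP: (gradient_eq_neq0 x1P); apply/rowP=> a;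
    rewrite [RHS]mxE; apply: contrapT => /eqP xa; apply: nx; exists a.
have [d hd fd] : exists2 d, (msize h <= d)%N & forall a, (msize (f a) <= d)%N.
  exists (maxn (msize h) (\max_a msize (f a)))%N => [|a]; first exact: leq_maxl.
  by apply: leq_trans (leq_maxr _ _); apply: (leq_bigmax (F := fun a => msize (f a))).
pose p : #|edges g|.-tuple {mpoly F[#|edges g|]} := [tuple P^`M(i) | i < #|edges g|].
pose q : #|edges g|.-tuple {mpoly F[#|edges g|]} :=
  [tuple homogenize a1 d (f i) | i < #|edges g|].
have qh i : tnth q i \is d.-homog by rewrite tnth_mktuple dhomog_homogenize.
have ph i : tnth p i \is n.-1.-1.-homog by rewrite tnth_mktuple.
have pE i v : (tnth p i).@[v] = (P^`M(i)).@[v] by rewrite tnth_mktuple.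
have evalE (u : {mpoly F[#|edges g|]}) (v : 'I_#|edges g| -> F) (s : 'rV[F]_#|edges g|) :
    (forall a, v a = s 0 a) -> u.@[v] = u.@[s 0] by move=> vs; apply: meval_eq.
have qE s : s 0 a1 != 0 -> h.@[((s 0 a1)^-1 *: s) 0] != 0 ->
    exists2 x, gradient_eq x ((s 0 a1)^-1 *: s) &
    forall i, (tnth q i).@[s 0] = s 0 a1 ^+ d * h.@[((s 0 a1)^-1 *: s) 0] * x 0 i.
  move=> s0 hs; pose x := \row_a ((f a).@[((s 0 a1)^-1 *: s) 0] / h.@[((s 0 a1)^-1 *: s) 0]).
  exists x; first exact/hf.
  move=> j; rewrite tnth_mktuple homogenize_eval // mxE.
  rewrite (evalE _ _ ((s 0 a1)^-1 *: s)) => [|a]; last by rewrite mxE mulrC.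
  by field.
have hE s : s 0 a1 != 0 ->
    (homogenize a1 d h).@[s 0] = s 0 a1 ^+ d * h.@[((s 0 a1)^-1 *: s) 0].
  move=> s0; rewrite homogenize_eval //; congr (_ * _).
  by apply: evalE => a; rewrite mxE mulrC.
have ones1 : (ones 0 a1)^-1 *: ones = ones by rewrite mxE invr1 scale1r.
have one_neq0 : ones 0 a1 != 0 by rewrite mxE oner_neq0.
have comp_q i v : (tnth (ratmap_comp q p) i).@[v] = (tnth q i).@[fun j => (P^`M(j)).@[v]].
  by rewrite tnth_mktuple comp_mpoly_meval; apply: meval_eq => j.
have comp_p i v : (tnth (ratmap_comp p q) i).@[v] = (P^`M(i)).@[fun j => (tnth q j).@[v]].
  by rewrite tnth_mktuple comp_mpoly_meval tnth_mktuple; apply: meval_eq.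
(* The factors ensure in turn that the logarithmic gradient makes sense at x, that the gradient can
   be scaled to have coordinate [a1] equal to 1, and that [h] is nonzero at the scaled gradient. *)
pose hp := P * P^`M(a1) * (homogenize a1 d h \mPo p).
have qpE x : hp.@[x 0] != 0 -> exists2 c, c != 0 & forall i, (tnth (ratmap_comp q p) i).@[x 0] = c * x 0 i.
  rewrite !mevalM comp_mpoly_meval !mulf_eq0 !negb_or => /andP [/andP [Px dPx]].
  pose v : 'rV[F]_#|edges g| := \row_j (P^`M(j)).@[x 0].
  have vE j : (tnth p j).@[x 0] = v 0 j by rewrite pE mxE.
  rewrite (evalE _ _ v) // => hv.
  have v0 : v 0 a1 != 0 by rewrite mxE.
  move: hv; rewrite hE // mulf_eq0 negb_or => /andP [_ hv].
  have [y yv yq] := qE v v0 hv.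
  (* The resistances of x are v / P(x), and scaling x by a constant divides them by it. By
     uniqueness this multiple of x is the point [y] found by the inverse. *)
  have xv : gradient_eq ((v 0 a1 / P.@[x 0]) *: x) ((v 0 a1)^-1 *: v).
    have -> : (v 0 a1)^-1 *: v = (v 0 a1 / P.@[x 0])^-1 *: ((P.@[x 0])^-1 *: v).
      by rewrite scalerA; congr (_ *: _); field; rewrite v0 Px.
    apply: gradient_eqZ; first by rewrite mulf_neq0 ?invr_eq0.
    by split=> // a; rewrite !mxE mulrA divff // mul1r.
  have yE : y = (v 0 a1 / P.@[x 0]) *: x.
    by rewrite (proj1 (hf _ hv y) yv) -(proj1 (hf _ hv _) xv).
  exists (v 0 a1 ^+ d * h.@[((v 0 a1)^-1 *: v) 0] * (v 0 a1 / P.@[x 0])).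
    by rewrite !mulf_neq0 ?invr_eq0 ?expf_neq0.
  move=> i; rewrite comp_q (evalE (tnth q i) _ v) => [|j]; last by rewrite -vE pE.
  by rewrite yq yE [(_ *: x) 0 i]mxE mulrA.
have hp1 : hp.@[x1 0] != 0.
  rewrite !mevalM comp_mpoly_meval dP1 mxE mulr1 !mulf_neq0 //.
  (* All resistances of [x1] are 1, so all partial derivatives there equal P(x1) and the scaled
     gradient is [ones]. *)
  pose v : 'rV[F]_#|edges g| := \row_j P.@[x1 0].
  rewrite (evalE _ _ v) => [|j]; last by rewrite pE dP1 !mxE mulr1.
  have v0 : v 0 a1 != 0 by rewrite mxE.
  rewrite hE // mulf_neq0 ?expf_neq0 //.
  suff -> : (v 0 a1)^-1 *: v = ones by [].
  by apply/rowP=> j; rewrite !mxE mulVf.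
pose hq := 'X_a1 * homogenize a1 d h.
have pqE s : hq.@[s 0] != 0 -> exists2 c, c != 0 & forall i, (tnth (ratmap_comp p q) i).@[s 0] = c * s 0 i.
  rewrite mevalM mevalXU mulf_eq0 negb_or => /andP [s0].
  rewrite hE // mulf_eq0 negb_or => /andP [_ hs].
  have [y [Py dPy] yq] := qE s s0 hs.
  set c := s 0 a1 ^+ d * _ in yq; have c0 : c != 0 by rewrite mulf_neq0 ?expf_neq0.
  exists (c ^+ n.-1.-1 * P.@[y 0] / s 0 a1).
    by rewrite !mulf_neq0 ?invr_eq0 ?expf_neq0.
  move=> i; rewrite comp_p (meval_eq _ yq) (dhomog_eval _ _ (dPh i)) dPy mxE.
  by field.
have hq1 : hq.@[ones 0] != 0.
  by rewrite mevalM mevalXU mulf_neq0 // hE // ones1 mulf_neq0 ?expf_neq0.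
have idE i v : (tnth (ratmap_id F #|edges g|) i).@[v] = v i.
  by rewrite tnth_mktuple mevalXU.
split.
  split; first by exists n.-1.-1.
  exists a1; apply: contraTneq P1 => p0; rewrite negbK.
  by have := dP1 a1; rewrite -pE p0 meval0 mxE mulr1 => <-.
exists q; split; [|split|split].
- split; first by exists d.
  have := qE _ one_neq0; rewrite ones1 => /(_ h1) [x /(hf _ h1) xE xq].
  exists a1; apply: contraTneq x1a1 => q0; move: (xq a1); rewrite q0 meval0 => /esym/eqP.
  by rewrite !mulf_eq0 expf_eq0 (negPf h1) (negPf one_neq0) andbF /= negbK xE.
- split; first by exists (d * n.-1.-1)%N => i; rewrite tnth_mktuple dhomog_comp.
  have [c c0 cE] := qpE x1 hp1.
  by exists a1; apply: contraTneq x1a1 => c1; have := cE a1; rewrite c1 meval0 =>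
    /esym/eqP; rewrite mulf_eq0 (negPf c0) /= negbK.
- move=> i j; apply: (mpoly_eq_dense hp1) => x /qpE [c _ cE].
  by rewrite !mevalM !idE !cE mulrAC.
- split; first by exists (n.-1.-1 * d)%N => i; rewrite tnth_mktuple dhomog_comp.
  have [c c0 cE] := pqE ones hq1.
  by exists a1; apply: contraTneq one_neq0 => c1; have := cE a1; rewrite c1 meval0 =>
    /esym/eqP; rewrite mulf_eq0 (negPf c0) /= negbK.
- move=> i j; apply: (mpoly_eq_dense hq1) => x /pqE [c _ cE].
  by rewrite !mevalM !idE !cE mulrAC.
Qed.

(** Off-diagonal entries are the weights of the edges avoiding [k]; once these vanish, a diagonal
    entry is the weight of the edge to [k]. This gives the linear independence of the edge
    matrices. *)
Lemma reduced_laplacian_inj0 x k : reduced_laplacian x k = 0 -> x = 0.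
Proof.
move=> /matrixP L0.
have off i j : i != j -> edge_weight x (lift k i) (lift k j) = 0.
  move=> ij; have := L0 i j; rewrite !mxE (inj_eq lift_inj) (negPf ij) => /eqP.
  by rewrite oppr_eq0 => /eqP.
have base i : edge_weight x (lift k i) k = 0.
  have := L0 i i; rewrite !mxE eqxx; case gik : (g (lift k i) k); last first.
    by rewrite edge_weight_eq0 ?gik.
  rewrite (bigD1 k) //= big1 ?addr0 // => l /andP [gl lk].
  move: gl; case: (unliftP k l) => [j ->|lk']; last by rewrite lk' eqxx in lk.
  move=> gij; apply: off; apply: contraTneq gij => ->; by rewrite girr.
apply/rowP=> a; rewrite [RHS]mxE; have [u [v [guv ae]]] := edge_valP a.
rewrite -(edge_weight_eq x ae); move: guv {ae}.
case: (unliftP k u) => [i ->|->]; case: (unliftP k v) => [j ->|->].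
- by move=> gij; apply: off; apply: contraTneq gij => ->; rewrite girr.
- by rewrite base.
- by rewrite edge_weightC base.
- by rewrite girr.
Qed.

Lemma edge_mxs_parametrizes k : parametrizes (edge_mxs g k F) (tree_model g F k).
Proof.
split=> [a||].
- by rewrite tnth_mktuple; apply: reduced_laplacian_sym.
- apply/freeP=> c c0 a.
  have : reduced_laplacian (\row_b c b : 'rV[F]_#|edges g|) k = 0.
    rewrite reduced_laplacian_sum // -[RHS]c0; apply: eq_bigr => b _.
    by rewrite mxE (tnth_nth 0).
  by move=> /reduced_laplacian_inj0 /rowP /(_ a); rewrite !mxE.
apply/seteqP; split=> A /= [x ->]; exists x; by rewrite reduced_laplacian_sum.
Qed.

Theorem tree_model_ml_degree k : ml_degree (tree_model g F k) 1.
Proof.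
exists #|edges g|, (edge_mxs g k F); split; first exact: edge_mxs_parametrizes.
have [h [f [h1 hf]]] := gradient_inverse.
pose K := edge_mxs g k F.
(* The linear form tr (S K_a) in the entries of S, through which the condition on [h] is pulled back
   to S. *)
pose l a : {mpoly F[n.-1 * n.-1]} :=
  \sum_i \sum_j (tnth K a j i) *: 'X_(mxvec_index i j).
pose s S : 'rV[F]_#|edges g| := \row_a \tr (S *m tnth K a).
have lE S a : (l a).@[mxvec S 0] = s S 0 a.
  rewrite mxE /l rmorph_sum; apply: eq_bigr => i _; rewrite rmorph_sum mxE.
  by apply: eq_bigr => j _; rewrite /= mevalZ mevalXU mxvecE mulrC.
have hE S : (h \mPo [tuple l a | a < #|edges g|]).@[mxvec S 0] = h.@[s S 0].
  by rewrite comp_mpoly_meval; apply: meval_eq => a; rewrite tnth_mktuple lE.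
exists (h \mPo [tuple l a | a < #|edges g|]); split.
  (* All the resistances of S are 1. *)
  pose R (u v : 'I_n) : F := (u != v)%:R.
  have RC u v : R u v = R v u by rewrite /R eq_sym.
  have R0 u : R u u = 0 by rewrite /R eqxx.
  exists (\matrix_(i, j) gram k R (lift k i) (lift k j)); split.
    apply/matrixP=> i j; rewrite !mxE /gram [R (lift k j) (lift k i)]RC.
    by rewrite [R (lift k j) k + _]addrC.
  rewrite hE; suff -> : s (\matrix_(i, j) gram k R (lift k i) (lift k j)) = ones by [].
  apply/rowP=> a; rewrite !mxE mxtrace_mulC tnth_mktuple.
  have [i [j [gij ae]]] := edge_valP a.
  rewrite (edge_mx_gram_trace gsym girr ae) => [|v|v]; last 2 first.
  - by rewrite /gram R0 RC; field.
  - by rewrite /gram R0; field.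
  rewrite /gram !R0 [R j i]RC; transitivity (R i j); first by field.
  by rewrite /R (_ : i != j) //; apply: contraTneq gij => ->; rewrite girr.
move=> S _; rewrite hE => hs.
exists [:: \row_a ((f a).@[s S 0] / h.@[s S 0])]; split=> // x.
suff cE : gradient_eq x (s S) <-> critical_point K S x.
  by rewrite inE; split=> [/eqP/(hf _ hs)/cE|/cE/(hf _ hs)/eqP].
rewrite /gradient_eq (tree_poly_det_poly k gsym girr) -/K.
split=> -[D0 dD]; split=> // a; have := dD a.
  by rewrite mxE => ->; rewrite mulrAC divff // mul1r.
by rewrite mxE => <-; rewrite mulrC divfK.
Qed.

End GradientInverse.

Local Open Scope complex_scope.

Theorem theorem2p9 (R : realType) (n : nat) (g : rel 'I_n) :
  (2 <= n)%N ->
  ssrbool.symmetric g -> irreflexive g ->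
  connected_graph g ->
  chordal g ->
  homaloidal (tree_poly g R[i]) /\
  (forall k : 'I_n, ml_degree (tree_model g R[i] k) 1).
Proof.
move=> n2 gsym girr gcon gch; split=> [|k]; first exact: tree_poly_homaloidal.
exact: tree_model_ml_degree.
Qed.
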